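(* Assume the 3SUM-hardness assumption (stated in the context). Consider the jumbled indexing problem with text size $s$ over an alphabet of size $r \ge 5$. Then for any fixed $\epsilon > 0$, any algorithm for jumbled indexing satisfies at least one of the following: (1) its preprocessing time is $\Omega(s^{2-\frac{4}{r}-\epsilon})$, or (2) its query time is $\Omega(s^{1-\frac{2}{r}-\epsilon})$.
   Context: Model: Word RAM with words of $O(\log n)$ bits. The Parikh vector of a string $S$ over alphabet $\Sigma=\{\sigma_1,\dots,\sigma_{|\Sigma|}\}$ is $\psi(S)=(c_1(S),\dots,c_{|\Sigma|}(S))$, where $c_i(S)$ is the number of occurrences of $\sigma_i$ in $S$. Jumbled indexing: preprocess a text $S$ of length $s$ over alphabet $\Sigma$ so that, given a query vector $\psi\in\mathbb{N}^{|\Sigma|}$, one can decide whether some substring $S'$ of $S$ has Parikh vector $\psi(S')=\psi$. Convolution-3SUM: given integers $x_1,\dots,x_n$, decide whether there exist distinct indices $i,j$ with $x_i - x_j = x_{i-j}$. 3SUM-hardness assumption: any (possibly randomized) algorithm for Convolution-3SUM requires $n^{2-o(1)}$ expected time to decide, for input $\{x_1,\dots,x_n\}\subset\{-n^2,\dots,n^2\}$, whether there is a pair $x_i,x_j$ with $x_i-x_j=x_{i-j}$. *)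

(* Defs.v *)
(* MathComp + MathComp-Analysis *)
From HB Require Import structures.
From mathcomp Require Import all_boot all_order all_algebra.
From mathcomp Require Import all_classical all_reals all_analysis.

Set Implicit Arguments.
Unset Strict Implicit.
Unset Printing Implicit Defensive.

Import Order.TTheory GRing.Theory Num.Theory.
Import numFieldNormedType.Exports.

Local Open Scope classical_set_scope.

(* Word RAM.  A word is a natural number below 2 ^ w.  A program is a fixed
   list of unit-cost instructions; it acts on registers (named by the program,
   so only finitely many are used) and on a memory addressed by words.  An
   instruction whose result is not a word cannot be executed: the machine then
   never halts.  No operation depends on w otherwise, so a program remains valid
   when w grows. *)
Variant binop : Set :=
  OpAdd | OpSub | OpMul | OpDiv | OpMod | OpAnd | OpOr | OpXor
| OpShl | OpShr | OpEq | OpLt.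

Definition eval_op (o : binop) (a b : nat) : nat :=
  match o with
  | OpAdd => a + b
  | OpSub => a - b
  | OpMul => a * b
  | OpDiv => a %/ b
  | OpMod => a %% b
  | OpAnd => Nat.land a b
  | OpOr => Nat.lor a b
  | OpXor => Nat.lxor a b
  | OpShl => a * 2 ^ b
  | OpShr => a %/ 2 ^ b
  | OpEq => a == b
  | OpLt => a < b
  end.

Variant instr : Set :=
| Const of nat & nat               (* Const d v    : R[d] := v *)
| Move of nat & nat                (* Move d a     : R[d] := R[a] *)
| Binop of binop & nat & nat & nat (* Binop o d a b: R[d] := R[a] o R[b] *)
| Read of nat & nat                (* Read d a     : R[d] := M[R[a]] *)
| Write of nat & nat               (* Write a b    : M[R[a]] := R[b] *)
| Flip of nat                      (* Flip d       : R[d] := a random bit *)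
| Jump of nat                      (* Jump l       : goto l *)
| JumpZ of nat & nat.              (* JumpZ a l    : if R[a] = 0 goto l *)

Definition program := seq instr.

(* [tape] is the number of random bits consumed so far. *)
Record config := Config {
  pc : nat; regs : nat -> nat; memory : nat -> nat; tape : nat }.

Definition upd (f : nat -> nat) (a v : nat) : nat -> nat :=
  fun b => if b == a then v else f b.

Definition set_reg (w : nat) (k : config) (a v : nat) : option config :=
  if v < 2 ^ w then Some (Config (pc k).+1 (upd (regs k) a v) (memory k) (tape k))
  else None.

Definition set_mem (w : nat) (k : config) (a v : nat) : option config :=
  if (a < 2 ^ w) && (v < 2 ^ w)
  then Some (Config (pc k).+1 (regs k) (upd (memory k) a v) (tape k))
  else None.

(* [xi] is the sequence of random bits.  [None] is returned both on overflow and
   when the program counter is outside the program; the latter is halting, see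
   [halts]. *)
Definition step (w : nat) (p : program) (xi : nat -> bool) (k : config) :
    option config :=
  match onth p (pc k) with
  | None => None
  | Some (Const d v) => set_reg w k d v
  | Some (Move d a) => set_reg w k d (regs k a)
  | Some (Binop o d a b) => set_reg w k d (eval_op o (regs k a) (regs k b))
  | Some (Read d a) =>
      if regs k a < 2 ^ w then set_reg w k d (memory k (regs k a)) else None
  | Some (Write a b) => set_mem w k (regs k a) (regs k b)
  | Some (Flip d) =>
      set_reg w (Config (pc k) (regs k) (memory k) (tape k).+1) d (xi (tape k))
  | Some (Jump l) => Some (Config l (regs k) (memory k) (tape k))
  | Some (JumpZ a l) =>
      Some (Config (if regs k a == 0 then l else (pc k).+1)
              (regs k) (memory k) (tape k))
  end.

(* [p], started in [k], halts after exactly [t] steps, in [k'].  As [step] is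
   undefined on a halted configuration, [t] and [k'] are unique. *)
Definition halts (w : nat) (p : program) (xi : nat -> bool) (k : config)
    (t : nat) (k' : config) : Prop :=
  iter t (obind (step w p xi)) (Some k) = Some k' /\ size p <= pc k'.

(* Words of c * (floor (log2 n) + 1) bits, for a constant c >= 1. *)
Definition word_bits (c n : nat) : nat := c * (trunc_log 2 n).+1.

(* A decision is read in register 0. *)
Definition decides (k : config) (Q : Prop) : Prop :=
  (regs k 0 = 1 /\ Q) \/ (regs k 0 = 0 /\ ~ Q).

(* The size is in register 0, the input in memory from address 0 on;
   everything else is 0. *)
Definition start (n : nat) (input : seq nat) : config :=
  Config 0 (fun i => if i == 0 then n else 0) (nth 0 input) 0.

Section Randomness.
Context (R : realType) (d : measure_display) (Om : measurableType d).

(* [coin i] is the i-th of a sequence of independent fair coin tosses. *)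
Definition fair_coins (P : probability Om R) (coin : nat -> Om -> bool) : Prop :=
  (forall i, measurable [set x | coin i x]) /\
  (forall (m : nat) (b : nat -> bool),
     P [set x | forall i, i < m -> coin i x = b i] = ((2^-1 ^+ m)%R)%:E).

(* The running time, given the set of all numbers of steps after which the
   machine halts (at most one): +oo when this set is empty. *)
Definition running_time (D : set nat) : \bar R :=
  ereal_inf [set (t%:R)%:E | t in D].

(* Omega in the sense of Hardy and Littlewood, i.e. the negation of little-o:
   f s >= C * g s for arbitrarily large s.  (With "for all large s", an algorithm
   trading preprocessing for queries in a way that depends on the parity of s
   would refute any lower bound on one of the two times.) *)
Definition Omega (f : nat -> \bar R) (g : nat -> R) : Prop :=
  exists2 C : R, (0 < C)%R &
    forall N : nat, exists2 s, N <= s & ((C * g s)%R%:E <= f s)%E.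

End Randomness.

(* Convolution-3SUM; the tuple [x] is x_1, ..., x_n, so x_k is nth 0 x k.-1.
   i and j are distinct and i - j has to be an index, hence j < i. *)
Definition conv3sum (n : nat) (x : n.-tuple int) : Prop :=
  exists i j : nat, [/\ 0 < j, j < i, i <= n
    & (nth 0 x i.-1 - nth 0 x j.-1 = nth 0 x (i - j).-1)%R].

Definition conv3sum_range (n : nat) (x : n.-tuple int) : Prop :=
  forall a, a \in (x : seq int) -> (- (n ^ 2)%:Z <= a <= (n ^ 2)%:Z)%R.

(* Integers of the range are stored with offset n ^ 2. *)
Definition conv3sum_start (n : nat) (x : n.-tuple int) : config :=
  start n [seq absz (a + (n ^ 2)%:Z)%R | a <- x].

Record conv3sum_alg := Conv3sumAlg {
  conv_prog : program;
  conv_word : nat }.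

Section Conv3sum.
Context (R : realType) (d : measure_display) (Om : measurableType d).
Context (P : probability Om R) (coin : nat -> Om -> bool) (A : conv3sum_alg).

Definition conv3sum_halts (n : nat) (x : n.-tuple int) (om : Om) :=
  halts (word_bits (conv_word A) n) (conv_prog A) (coin^~ om)
    (conv3sum_start x).

Definition solves_conv3sum : Prop :=
  0 < conv_word A /\
  forall (n : nat) (x : n.-tuple int), conv3sum_range x ->
    {ae P, forall om, exists t k, conv3sum_halts x om t k /\
                                  decides k (conv3sum x)}.

Definition conv3sum_time (n : nat) : \bar R :=
  ereal_sup [set (\int[P]_om
      running_time R [set t | exists k, conv3sum_halts x om t k])%E
    | x in [set x : n.-tuple int | conv3sum_range x]].

End Conv3sum.

(* Every algorithm takes expected time n ^ (2 - o(1)) (for arbitrarily large n,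
   as in [Omega]). *)
Definition conv3sum_hard (R : realType) (d : measure_display)
    (Om : measurableType d) (P : probability Om R) (coin : nat -> Om -> bool) :
    Prop :=
  forall A : conv3sum_alg, solves_conv3sum P coin A ->
    exists2 e : nat -> R, e n @[n --> \oo] --> (0 : R)%R &
      forall N : nat, exists2 n, N <= n &
        (((n%:R : R) `^ (2 - e n))%R%:E <= conv3sum_time P coin A n)%E.

(* Jumbled indexing, over the alphabet {0, ..., r-1}. *)
Definition parikh (r : nat) (S : seq 'I_r) : r.-tuple nat :=
  [tuple count_mem i S | i < r].

Definition jumbled_occurs (r : nat) (S : seq 'I_r) (psi : r.-tuple nat) : Prop :=
  exists S' : seq 'I_r, infix S' S /\ parikh S' = psi.

(* The query program runs on the registers and memory left by the preprocessing
   and the previous queries, after psi has been put in registers 0, ..., r-1. *)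
Definition load_query (r : nat) (psi : r.-tuple nat) (k : config) : config :=
  Config 0 (fun i => if i < r then nth 0 psi i else regs k i) (memory k) (tape k).

Record jumbled_alg := JumbledAlg {
  pre_prog : program;
  query_prog : program;
  jumbled_word : nat }.

Section Jumbled.
Context (R : realType) (d : measure_display) (Om : measurableType d).
Context (P : probability Om R) (coin : nat -> Om -> bool).
Context (r : nat) (A : jumbled_alg).

Definition pre_halts (s : nat) (S : s.-tuple 'I_r) (om : Om) :=
  halts (word_bits (jumbled_word A) s) (pre_prog A) (coin^~ om)
    (start s [seq val a | a <- S]).

Definition query_halts (s : nat) (om : Om) (psi : r.-tuple nat) (k : config) :=
  halts (word_bits (jumbled_word A) s) (query_prog A) (coin^~ om)
    (load_query psi k).

(* [session S om psis k]: after preprocessing S and then answering the queries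
   psis (latest first), the configuration is k. *)
Fixpoint session (s : nat) (S : s.-tuple 'I_r) (om : Om)
    (psis : seq (r.-tuple nat)) (k : config) : Prop :=
  match psis with
  | [::] => exists t, pre_halts S om t k
  | psi :: psis' =>
      exists k0 t, session S om psis' k0 /\ query_halts s om psi k0 t k
  end.

(* Query vectors consist of words. *)
Definition word_query (s : nat) (psi : r.-tuple nat) : Prop :=
  forall a, a \in (psi : seq nat) -> a < 2 ^ word_bits (jumbled_word A) s.

Definition word_queries (s : nat) (psis : seq (r.-tuple nat)) : Prop :=
  forall psi, psi \in psis -> word_query s psi.

Definition solves_jumbled : Prop :=
  0 < jumbled_word A /\
  forall (s : nat) (S : s.-tuple 'I_r),
    {ae P, forall om, exists t k, pre_halts S om t k} /\
    forall (psis : seq (r.-tuple nat)) (psi : r.-tuple nat),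
      word_queries s (psi :: psis) ->
      {ae P, forall om, exists k t k', [/\ session S om psis k,
         query_halts s om psi k t k' & decides k' (jumbled_occurs S psi)]}.

(* Worst-case expected times; a query may come after any other queries. *)
Definition preprocessing_time (s : nat) : \bar R :=
  ereal_sup [set (\int[P]_om
      running_time R [set t | exists k, pre_halts S om t k])%E
    | S in [set: s.-tuple 'I_r]].

Definition query_time (s : nat) : \bar R :=
  ereal_sup [set z | exists (S : s.-tuple 'I_r) (psis : seq (r.-tuple nat))
      (psi : r.-tuple nat), word_queries s (psi :: psis) /\
    z = (\int[P]_om running_time R
           [set t | exists k k', session S om psis k /\
                                 query_halts s om psi k t k'])%E].

End Jumbled.

(* Main.v *)
Require Import Defs.
From mathcomp Require Import all_boot all_order all_algebra.
From mathcomp Require Import all_classical all_reals all_analysis measurable_realfun.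
From mathcomp Require Import zify ring lra.
Import Order.TTheory GRing.Theory Num.Theory.

Set Implicit Arguments.
Unset Strict Implicit.
Unset Printing Implicit Defensive.

(** Write the shifted integers y_i = x_i + n^2 in base B with p + 1 = r - 2
    digits, where B is least with B^(p+1) > 2 n^2, and let the i-th block of the
    text consist of a separator, of B + (c-th digit of y_(i+1)) - (c-th digit of
    y_i) copies of the letter c for every digit position c, and of filler up to
    a fixed length L.  A substring of length k L + 1 with k + 1 separators has to
    start at a separator, and by telescoping its Parikh vector is given by the
    digitwise differences of some y_(i+k) and y_i.  So x_(i+k) - x_i = x_k has a
    solution i if and only if one of at most 2^p queries succeeds, one for every
    choice of the borrows in the subtraction.  The text has length
    s = O(n B) = O(n^(r/(r-2))), so that a preprocessing time of
    s^(2-4/r-eps) and n 2^p queries of time s^(1-2/r-eps) each would solve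
    Convolution-3SUM in time O(n^(2-eps)).  All queries are asked, whatever the
    answers, so that the sequence of queries does not depend on the coins. *)

(** * Structured programs on the word RAM *)

(** Separator and filler take two letters, so r - 2 remain for digits; hence the exponent r/(r-2).
    The summand B keeps letter counts nonnegative, and a query uses u = x_k + B^(p+1) likewise. The
    borrows are the carries of the addition u + y_i = B^(p+1) + y_(i+k); the last carry is known,
    which leaves 2^p guesses. A wrong guess gives no false positive, since agreement of all digits
    already implies the equation. Hardness is about programs, so the reduction must be a single one:
    it runs preprocessing and queries as simulated programs, two steps per step, with their memory
    displaced behind the input. It flips no coin itself, so the data structure sees exactly the
    given coins and expected times add up by linearity. Failure of [Omega] gives upper bounds for
    all large s; as s >= n, they hold at the unspecified lengths n where Convolution-3SUM is hard.
    Replacing eps by min(eps, 1/3) keeps both exponents nonnegative and the cost of writing the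
    text, at most about n^(5/3), within n^(2-eps). *)

Inductive cmd : Type :=
| Basic of seq instr
| Seq of cmd & cmd
| While of nat & cmd
| Sim of program.

(* The registers of the simulated machine; those below 16 belong to the
   simulating program. *)
Definition sreg (i : nat) : nat := i.+4.+4.+4.+4.

(* Exactly two instructions per simulated instruction, so that the simulated
   address l is b + l.*2; register 0 holds the displacement of the simulated
   memory and register 1 is scratch. *)
Definition sim_instr (b z : nat) (i : instr) : seq instr :=
  match i with
  | Const d v => [:: Const 1 0; Const (sreg d) v]
  | Move d a => [:: Const 1 0; Move (sreg d) (sreg a)]
  | Binop o d a a' => [:: Const 1 0; Binop o (sreg d) (sreg a) (sreg a')]
  | Read d a => [:: Binop OpAdd 1 0 (sreg a); Read (sreg d) 1]
  | Write a a' => [:: Binop OpAdd 1 0 (sreg a); Write 1 (sreg a')]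
  | Flip d => [:: Const 1 0; Flip (sreg d)]
  | Jump l => [:: Const 1 0; Jump (b + (minn l z).*2)]
  | JumpZ a l => [:: Const 1 0; JumpZ (sreg a) (b + (minn l z).*2)]
  end.

Fixpoint csize (c : cmd) : nat :=
  match c with
  | Basic l => size l
  | Seq c1 c2 => csize c1 + csize c2
  | While _ c => (csize c).+2
  | Sim p => (size p).*2
  end.

Fixpoint compile (c : cmd) (b : nat) : program :=
  match c with
  | Basic l => l
  | Seq c1 c2 => compile c1 b ++ compile c2 (b + csize c1)
  | While a c => JumpZ a (b + (csize c).+2) :: compile c b.+1 ++ [:: Jump b]
  | Sim p => flatten [seq sim_instr b (size p) i | i <- p]
  end.

Lemma size_compile c b : size (compile c b) = csize c.
Proof.
elim: c b => //= [c1 IH1 c2 IH2|a c IH|p] b.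
- by rewrite size_cat IH1 IH2.
- by rewrite size_cat /= IH addn1.
- rewrite size_flatten /shape -map_comp.
  rewrite (@eq_map _ _ _ (fun=> 2)); last by case.
  by elim: p => //= i p ->; rewrite doubleS.
Qed.

Definition goto (k : config) (l : nat) : config :=
  Config l (regs k) (memory k) (tape k).

Definition setr (k : config) (a v : nat) : config :=
  Config (pc k) (upd (regs k) a v) (memory k) (tape k).

Definition setm (k : config) (a v : nat) : config :=
  Config (pc k) (regs k) (upd (memory k) a v) (tape k).

Local Arguments onth : simpl never.

(** * Program logic: context-independent runs, time bounds and weakest preconditions *)

Section Logic.
Variables (w : nat) (xi : nat -> bool).

(** Jump targets are absolute, so the code is compiled at the address [size pre] where it stands;
    quantifying over the surrounding code is what lets runs be composed. The [goto]s discard the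
    program counters of [k] and [k']. *)
Definition runs (c : cmd) (k : config) (t : nat) (k' : config) : Prop :=
  forall pre suf : program,
    iter t (obind (step w (pre ++ compile c (size pre) ++ suf) xi))
      (Some (goto k (size pre))) = Some (goto k' (size pre + csize c)).

Definition ends_within (c : cmd) (t : nat) (Q : config -> Prop) (k : config) : Prop :=
  exists t' k', [/\ t' <= t, runs c k t' k' & Q k'].

(** Weakest precondition of straight-line code, the side conditions excluding overflow. Jumps come
    only from [While] and [Sim], and coins are flipped only by simulated programs, so these
    instructions are mapped to [False]. *)
Fixpoint wp (l : seq instr) (Q : config -> Prop) (k : config) : Prop :=
  match l with
  | [::] => Q k
  | Const d v :: l' => v < 2 ^ w /\ wp l' Q (setr k d v)
  | Move d a :: l' => regs k a < 2 ^ w /\ wp l' Q (setr k d (regs k a))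
  | Binop o d a b :: l' =>
      let v := eval_op o (regs k a) (regs k b) in
      v < 2 ^ w /\ wp l' Q (setr k d v)
  | Read d a :: l' =>
      let v := memory k (regs k a) in
      [/\ regs k a < 2 ^ w, v < 2 ^ w & wp l' Q (setr k d v)]
  | Write a b :: l' =>
      [/\ regs k a < 2 ^ w, regs k b < 2 ^ w
        & wp l' Q (setm k (regs k a) (regs k b))]
  | _ => False
  end.

Lemma onth_size_cat (T : Type) (s1 s2 : seq T) x : onth (s1 ++ x :: s2) (size s1) = Some x.
Proof. by elim: s1. Qed.

Lemma iter_obindD (T : Type) (f : T -> option T) t1 t2 x y z :
  iter t1 (obind f) (Some x) = Some y -> iter t2 (obind f) (Some y) = Some z ->
  iter (t1 + t2) (obind f) (Some x) = Some z.
Proof. by rewrite addnC iterD => ->. Qed.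

Lemma runs_Basic l Q k : wp l Q k -> exists k', runs (Basic l) k (size l) k' /\ Q k'.
Proof.
elim: l k => [|i l IH] k /=.
  by move=> Qk; exists k; split => // pre suf /=; rewrite addn0.
have cons k1 : (forall pre suf, step w (pre ++ (i :: l) ++ suf) xi (goto k (size pre)) =
      Some (goto k1 (size pre).+1)) -> wp l Q k1 ->
      exists k', runs (Basic (i :: l)) k (size l).+1 k' /\ Q k'.
  move=> s1 /IH[k' [r' Qk']]; exists k'; split=> // pre suf.
  rewrite -add1n; apply: (@iter_obindD _ _ 1 _ _ (goto k1 (size pre).+1)) => /=.
    exact: s1.
  have := r' (rcons pre i) suf; rewrite /= cat_rcons size_rcons => ->.
  by rewrite addSnnS.
case: i cons => [d v|d a|o d a b|d a|a b|d|j|a j] cons //.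
- case=> hv; apply: cons => pre suf.
  by rewrite /step /= onth_size_cat /= /set_reg hv.
- case=> hv; apply: cons => pre suf.
  by rewrite /step /= onth_size_cat /= /set_reg hv.
- case=> hv; apply: cons => pre suf.
  by rewrite /step /= onth_size_cat /= /set_reg hv.
- case=> ha hv; apply: cons => pre suf.
  by rewrite /step /= onth_size_cat /= ha /set_reg hv.
- case=> ha hv; apply: cons => pre suf.
  by rewrite /step /= onth_size_cat /= /Defs.set_mem ha hv.
Qed.

Lemma ends_within_Basic l t Q k : size l <= t -> wp l Q k -> ends_within (Basic l) t Q k.
Proof. by move=> lt /runs_Basic[k' [r Qk']]; exists (size l), k'. Qed.

Lemma ends_within_mono c t1 t2 (Q1 Q2 : config -> Prop) k :
  t1 <= t2 -> (forall k', Q1 k' -> Q2 k') -> ends_within c t1 Q1 k -> ends_within c t2 Q2 k.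
Proof.
move=> t12 Q12 [t [k' [tt1 r /Q12 Qk']]]; exists t, k'; split=> //.
exact: leq_trans t12.
Qed.

Lemma runs_Seq c1 c2 k t1 k1 t2 k2 :
  runs c1 k t1 k1 -> runs c2 k1 t2 k2 -> runs (Seq c1 c2) k (t1 + t2) k2.
Proof.
move=> r1 r2 pre suf /=; apply: iter_obindD; first by rewrite -catA; exact: r1.
have := r2 (pre ++ compile c1 (size pre)) suf.
by rewrite -!catA size_cat size_compile addnA => ->.
Qed.

Lemma ends_within_Seq c1 c2 t1 t2 t Q k : t1 + t2 <= t ->
  ends_within c1 t1 (ends_within c2 t2 Q) k -> ends_within (Seq c1 c2) t Q k.
Proof.
move=> t12 [t1' [k1 [le1 r1 [t2' [k2 [le2 r2 Qk2]]]]]].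
exists (t1' + t2'), k2; split=> //; last exact: runs_Seq r1 r2.
exact: leq_trans (leq_add le1 le2) t12.
Qed.

Lemma runs_While_stop a c k : regs k a = 0 -> runs (While a c) k 1 k.
Proof.
by move=> ka pre suf /=; rewrite /step /= onth_size_cat /= ka.
Qed.

Lemma runs_While_iter a c k t k1 t' k2 : regs k a != 0 ->
  runs c k t k1 -> runs (While a c) k1 t' k2 ->
  runs (While a c) k (t.+2 + t') k2.
Proof.
move=> ka r1 r2 pre suf; apply: iter_obindD (r2 pre suf).
rewrite -addn1 -(add1n t); apply: (@iter_obindD _ _ _ _ _ (goto k1 (size pre + (csize c).+1))).
  apply: (@iter_obindD _ _ _ _ _ (goto k (size pre).+1)) => /=.
    by rewrite /step /= onth_size_cat /= (negbTE ka).
  have := r1 (rcons pre (JumpZ a (size pre + (csize c).+2))) (Jump (size pre) :: suf).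
  by rewrite size_rcons cat_rcons -!catA /= addSnnS.
rewrite /= /step /=; set J := JumpZ _ _.
have -> : size pre + (csize c).+1 = size (pre ++ J :: compile c (size pre).+1).
  by rewrite size_cat /= size_compile.
have -> : pre ++ J :: (compile c (size pre).+1 ++ [:: Jump (size pre)]) ++ suf =
    (pre ++ J :: compile c (size pre).+1) ++ Jump (size pre) :: suf.
  by rewrite -!catA /=.
by rewrite onth_size_cat.
Qed.

(** The number [N] of passes is known in advance and the invariant is indexed by the pass. Beyond
    its body, a pass costs the test and the jump back, whence [.+2]; the outer [.+1] is the last
    test, which leaves the loop. *)
Lemma ends_within_While a c N (tb : nat -> nat) (I : nat -> config -> Prop) k :
  (forall j k, j < N -> I j k -> regs k a != 0) ->
  (forall k, I N k -> regs k a = 0) ->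
  (forall j k, j < N -> I j k -> ends_within c (tb j) (I j.+1) k) ->
  I 0 k -> ends_within (While a c) (\sum_(j < N) (tb j).+2).+1 (I N) k.
Proof.
move=> pos0 stop body.
suff H j k1 : j <= N -> I j k1 ->
    ends_within (While a c) (\sum_(j <= i < N) (tb i).+2).+1 (I N) k1.
  by move=> /(H 0 k (leq0n N)); rewrite big_mkord.
(* Induction on the number of passes still to be made. *)
move=> {k} jN; rewrite -(subKn jN).
elim: (N - j) (leq_subr j N) k1 => [_|i IH iN] k1.
  rewrite subn0 => INk; exists 1, k1; split=> //.
  exact/runs_While_stop/stop.
have e : (N - i.+1).+1 = N - i by lia.
have lt : N - i.+1 < N by lia.
move=> Ik; have [t [k2 [ht r2]]] := body _ _ lt Ik.
rewrite e => /IH -/(_ (ltnW iN))[t' [k3 [ht' r3 Q3]]].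
exists (t.+2 + t'), k3; split=> //; last exact: runs_While_iter (pos0 _ _ lt Ik) r2 r3.
by rewrite big_ltn // e -addnS; apply: leq_add.
Qed.

End Logic.

(* [K] represents the simulated configuration [k]; [K0] fixes what the
   simulation leaves alone. *)
Definition sim_rel (K0 k K : config) : Prop :=
  [/\ forall i, regs K (sreg i) = regs k i,
      forall j, j < 16 -> j != 1 -> regs K j = regs K0 j,
      forall a, a < regs K0 0 -> memory K a = memory K0 a,
      forall a, memory K (regs K0 0 + a) = memory k a
    & tape K = tape k].

Lemma halted_step w p xi k : size p <= pc k -> step w p xi k = None.
Proof. by move=> h; rewrite /step onthE nth_default // size_map. Qed.

Lemma halts_uniq w p xi k t k1 t' k2 :
  halts w p xi k t k1 -> halts w p xi k t' k2 -> t = t' /\ k1 = k2.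
Proof.
have stop i k0 : size p <= pc k0 -> iter i.+1 (obind (step w p xi)) (Some k0) = None.
  by move=> h; rewrite iterSr /= (halted_step w xi h); elim: i => //= i ->.
move=> [e1 h1] [e2 h2].
have [tt'|t't|tt'] := ltngtP t t'.
- by move: e2; rewrite -(subnK tt') addnS -addSn iterD e1 stop.
- by move: e1; rewrite -(subnK t't) addnS -addSn iterD e2 stop.
- by split=> //; move: e1; rewrite tt' e2 => -[].
Qed.

(** * Simulation of a program with shorter words and displaced memory *)

Section Simulation.
Variables (w ws : nat) (xi : nat -> bool) (p : program).

Lemma onth_flatten_sim b z (pre suf : program) i l :
  onth p l = Some i ->
  exists q1 q2, [/\ pre ++ flatten [seq sim_instr b z j | j <- p] ++ suf =
     q1 ++ sim_instr b z i ++ q2 & size q1 = size pre + l.*2].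
Proof.
elim: p l pre => [|j p' IH] [|l] pre //=.
  case=> <-; exists pre, (flatten [seq sim_instr b z i | i <- p'] ++ suf).
  by rewrite addn0 !catA.
move=> /(IH _ (pre ++ sim_instr b z j))[q1 [q2 [e s1]]].
exists q1, q2; rewrite -e -!catA; split=> //; rewrite s1 size_cat doubleS.
have -> : size (sim_instr b z j) = 2 by case: j {e s1}.
by lia.
Qed.

(** A simulated jump may lead anywhere beyond the end of [p]; clipping by [minn] sends all such
    targets to the first address after the simulating code, so that halting becomes falling through.
    The hypothesis on [w] makes every displaced address a word. *)
Lemma sim_step K0 k k1 K : 2 ^ ws + regs K0 0 <= 2 ^ w ->
  step ws p xi k = Some k1 -> sim_rel K0 k K ->
  exists K1, sim_rel K0 k1 K1 /\ forall pre suf : program,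
    iter 2 (obind (step w (pre ++ compile (Sim p) (size pre) ++ suf) xi))
      (Some (goto K (size pre + (minn (pc k) (size p)).*2))) =
    Some (goto K1 (size pre + (minn (pc k1) (size p)).*2)).
Proof.
move=> hw; rewrite /step; case E: (onth p (pc k)) => [i|//] s1 [Hr Hl Hm HM Ht].
have lt_pc : pc k < size p.
  by rewrite ltnNge; apply: contraPN E => h; rewrite onthE nth_default ?size_map.
have e0 := Hl 0 isT isT.
have w0 : 0 < 2 ^ w by rewrite expn_gt0.
have lews v : v < 2 ^ ws -> v < 2 ^ w by move=> hv; lia.
have ex (pre suf : program) := @onth_flatten_sim (size pre) (size p) pre suf i _ E.
have mS : minn (pc k).+1 (size p) = (pc k).+1 by lia.
have mK : minn (pc k) (size p) = pc k by lia.
have next2 (q1 q2 : program) x y : onth (q1 ++ [:: x, y & q2]) (size q1).+1 = Some y.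
  by rewrite -cat1s catA -addn1 -[X in _ + X]/(size [:: x]) -size_cat onth_size_cat.
have scr (v : nat) j : upd (regs K) 1 v (sreg j) = regs k j by rewrite /upd /= Hr.
have set d v u tK : sim_rel K0 (Config (pc k).+1 (upd (regs k) d v) (memory k) tK)
      (Config (pc k).+1 (upd (upd (regs K) 1 u) (sreg d) v) (memory K) tK).
  split=> //= [j|j hj j1].
    by rewrite /upd /sreg !eqSS /= -/(sreg j) Hr.
  have jd : (j == sreg d) = false by rewrite /sreg; lia.
  by rewrite /upd jd (negbTE j1) Hl.
have jmp l u : sim_rel K0 (Config l (regs k) (memory k) (tape k))
    (Config l (upd (regs K) 1 u) (memory K) (tape k)).
  by split=> //= j hj j1; rewrite /upd (negbTE j1) Hl.
have step2 K1 : (forall (q1 q2 : program) b, size q1 = b + (pc k).*2 ->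
    obind (step w (q1 ++ sim_instr b (size p) i ++ q2) xi)
       (step w (q1 ++ sim_instr b (size p) i ++ q2) xi (goto K (size q1))) =
    Some (goto K1 (b + (minn (pc k1) (size p)).*2))) ->
  forall pre suf : program,
    iter 2 (obind (step w (pre ++ compile (Sim p) (size pre) ++ suf) xi))
      (Some (goto K (size pre + (minn (pc k) (size p)).*2))) =
    Some (goto K1 (size pre + (minn (pc k1) (size p)).*2)).
  move=> H pre suf; have [q1 [q2 [/= -> sq]]] := ex pre suf.
  by rewrite mK -sq; exact: H.
case: i E s1 {ex} step2 => [d v|d a|o d a a'|d a|a a'|d|l|a l] E s1 step2.
- move: s1; rewrite /set_reg; case: ifP => // hv e; case: e step2 => <- step2.
  eexists; split; [exact: (set d v 0)|apply: step2 => q1 q2 b sq].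
  rewrite [step _ _ _ (goto K _)]/step /= onth_size_cat /set_reg w0 /= /step /= next2 /set_reg /=.
  by rewrite lews // mS Ht sq /= -addnS -addnS doubleS.
- move: s1; rewrite /set_reg; case: ifP => // hv e; case: e step2 => <- step2.
  eexists; split; [exact: (set d (regs k a) 0)|apply: step2 => q1 q2 b sq].
  rewrite [step _ _ _ (goto K _)]/step /= onth_size_cat /set_reg w0 /= /step /= next2 /set_reg /=.
  by rewrite scr lews // mS Ht sq /= -addnS -addnS doubleS.
- move: s1; rewrite /set_reg; case: ifP => // hv e; case: e step2 => <- step2.
  eexists; split; [exact: (set d (eval_op o (regs k a) (regs k a')) 0)|apply: step2 => q1 q2 b sq].
  rewrite [step _ _ _ (goto K _)]/step /= onth_size_cat /set_reg w0 /= /step /= next2 /set_reg /=.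
  by rewrite !scr lews // mS Ht sq /= -addnS -addnS doubleS.
- move: s1; rewrite /set_reg; case: ifP => // ha; case: ifP => // hv e.
  case: e step2 => <- step2.
  have la : regs K0 0 + regs k a < 2 ^ w by lia.
  eexists; split; [exact: (set d (memory k (regs k a)) (regs K0 0 + regs k a))|apply: step2 => q1 q2 b sq].
  rewrite [step _ _ _ (goto K _)]/step /= onth_size_cat /set_reg Hr e0 la /= /step /= next2 /upd /=.
  by rewrite la HM /set_reg lews //= mS Ht sq /= -addnS -addnS doubleS.
- move: s1; rewrite /Defs.set_mem; case: ifP => // /andP[ha hv] e.
  case: e step2 => <- step2.
  have la : regs K0 0 + regs k a < 2 ^ w by lia.
  exists (Config (pc k).+1 (upd (regs K) 1 (regs K0 0 + regs k a))
    (upd (memory K) (regs K0 0 + regs k a) (regs k a')) (tape k)); split; last first.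
    apply: step2 => q1 q2 b sq.
    rewrite [step _ _ _ (goto K _)]/step /= onth_size_cat /set_reg Hr e0 la /= /step /= next2.
    rewrite scr {1}/upd /= /Defs.set_mem la lews //=.
    by rewrite mS Ht sq /= -addnS -addnS doubleS /goto /=.
  split=> //= [j hj j1|j hj|j].
  + by rewrite /upd (negbTE j1) Hl.
  + by rewrite /upd; case: eqP => [?|_]; [lia|exact: Hm].
  + by rewrite /upd eqn_add2l HM.
- move: s1; rewrite /set_reg; case: ifP => // hv e; case: e step2 => <- step2.
  eexists; split; [exact: (set d (xi (tape k) : nat) 0)|apply: step2 => q1 q2 b sq].
  rewrite [step _ _ _ (goto K _)]/step /= onth_size_cat /set_reg w0 /= /step /= next2 /set_reg /=.
  by rewrite Ht lews // mS sq /= -addnS -addnS doubleS.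
- case: s1 step2 => <- step2.
  eexists; split; [exact: (jmp l 0)|apply: step2 => q1 q2 b sq].
  by rewrite [step _ _ _ (goto K _)]/step /= onth_size_cat /set_reg w0 /= /step /= next2 /= Ht.
- case: s1 step2 => <- step2.
  eexists; split; [exact: (jmp _ 0)|apply: step2 => q1 q2 b sq].
  rewrite [step _ _ _ (goto K _)]/step /= onth_size_cat /set_reg w0 /= /step /= next2 /= scr Ht.
  by case: ifP => _ //; rewrite mS sq -addnS -addnS doubleS.
Qed.

Lemma runs_Sim K k t k' : 2 ^ ws + regs K 0 <= 2 ^ w ->
  sim_rel K k K -> pc k = 0 -> halts ws p xi k t k' ->
  exists K', runs w xi (Sim p) K t.*2 K' /\ sim_rel K k' K'.
Proof.
move=> hw R0 pc0 [it hp].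
suff [K' [R' r']] : exists K', sim_rel K k' K' /\ forall pre suf : program,
   iter t.*2 (obind (step w (pre ++ compile (Sim p) (size pre) ++ suf) xi))
      (Some (goto K (size pre))) = Some (goto K' (size pre + (minn (pc k') (size p)).*2)).
  exists K'; split=> // pre suf; rewrite r'.
  by move/minn_idPr: hp => ->.
elim: t k' it {hp} => [|t IH] k' /=.
  by case=> <-; exists K; split=> // pre suf; rewrite pc0 min0n addn0.
case E: (iter t _ _) => [k1|//] /= s1.
have [K1 [R1 e1]] := IH _ E.
have [K2 [R2 e2]] := sim_step hw s1 R1.
by exists K2; split=> // pre suf; rewrite (e1 pre suf) -(e2 pre suf).
Qed.

End Simulation.

(** * The text and the queries *)

(** Each of the [k] full periods contributes one multiple, and the remaining position is congruent
    to [a]. Separators stand at the multiples of the block size, so a count of [k + 1] forces the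
    window to start at one of them. *)
Lemma count_multiples L a k : 0 < L ->
  count (dvdn L) (iota a (k * L).+1) = k + (L %| a).
Proof.
move=> L0; have one b : count (dvdn L) (iota b L) = 1.
  elim: b => [|b IH].
    case: L L0 => // L _; rewrite /= (@eq_in_count _ _ pred0) ?count_pred0 //.
    by move=> j; rewrite mem_iota => jL; apply/negbTE; rewrite gtnNdvd //; lia.
  have : count (dvdn L) (iota b L.+1) = (L %| b) + count (dvdn L) (iota b.+1 L) by [].
  by rewrite -[L.+1]addn1 iotaD count_cat /= IH addn0 dvdn_addl //; lia.
elim: k a => [|k IH] a; first by rewrite /= addn0.
by rewrite mulSn -addnS iotaD count_cat one IH dvdn_addl // addnA.
Qed.

Section Encoding.
Variables (p B : nat).
Hypothesis B_gt1 : 1 < B.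

(* The letters 0, ..., p count base-B digits, p.+1 is a filler and p.+2 a
   separator. *)
Fixpoint digit_run (m c y y' : nat) : seq nat :=
  if m is m'.+1 then
    nseq (B + y' %% B - y %% B) c ++ digit_run m' c.+1 (y %/ B) (y' %/ B)
  else [::].

(** The digit letters number at most [2 * p.+1 * B]. The factor 3 also leaves room for the entries
    of an arbitrary query, whose top digit may exceed [B] (see [sumn_query_digits]). *)
Definition block (y y' : nat) : seq nat :=
  let ds := digit_run p.+1 0 y y' in
  p.+2 :: ds ++ nseq (3 * p.+1 * B - size ds) p.+1.

Definition block_size : nat := (3 * p.+1 * B).+1.

Definition text (n : nat) (y : nat -> nat) : seq nat :=
  flatten [seq block (y i) (y i.+1) | i <- iota 0 n.-1] ++ [:: p.+2].

Definition digit_diff (m k y y' : nat) : seq nat :=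
  mkseq (fun c => k * B + y' %/ B ^ c %% B - y %/ B ^ c %% B) m.

(* The low bits of [q] are the guesses for the borrows of the subtraction of the
   base-B numbers; [u] is the difference plus B ^ p.+1. *)
Fixpoint query_digits (m u q k : nat) : seq nat :=
  if m is m'.+1 then
    ((k - q %% 2) * B + u %% B) :: query_digits m' (u %/ B + q %% 2) (q %/ 2) k
  else [:: k.-1 * B + u].

(** The filler entry completes the total to [(k * block_size).+1], so that the vector prescribes the
    length of a matching substring: [k] blocks without their separators have [k * block_size - k]
    letters. *)
Definition query (u q k : nat) : seq nat :=
  let ds := query_digits p u q k in
  ds ++ [:: k * block_size - k - sumn ds; k.+1].

Let B_gt0 : 0 < B. Proof. exact: ltnW. Qed.

Lemma size_digit_run m c y y' : size (digit_run m c y y') <= 2 * m * B.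
Proof.
elim: m c y y' => //= m IH c y y'; rewrite size_cat size_nseq.
have := IH c.+1 (y %/ B) (y' %/ B); have := ltn_pmod y' B_gt0; nia.
Qed.

Local Arguments digit_run : simpl never.

Lemma digit_runS m c y y' : digit_run m.+1 c y y' =
  nseq (B + y' %% B - y %% B) c ++ digit_run m c.+1 (y %/ B) (y' %/ B).
Proof. by []. Qed.

Lemma size_block y y' : size (block y y') = block_size.
Proof.
rewrite /= size_cat size_nseq subnKC //.
by apply: leq_trans (size_digit_run _ _ _ _) _; rewrite -!mulnA leq_mul2r orbT.
Qed.

Lemma digit_diffS m k y y' : digit_diff m.+1 k y y' =
  (k * B + y' %% B - y %% B) :: digit_diff m k (y %/ B) (y' %/ B).
Proof.
rewrite /digit_diff /mkseq /= expn0 !divn1 -[1]addn0 iotaDl -map_comp.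
by congr cons; apply: eq_map => c /=; rewrite add1n expnS !divnMA.
Qed.

Lemma nth_digit_diff m k y y' c : c < m -> nth 0 (digit_diff m k y y') c =
  k * B + y' %/ B ^ c %% B - y %/ B ^ c %% B.
Proof. by move=> cm; rewrite nth_mkseq. Qed.

Lemma count_digit_run m c a y y' : count_mem a (digit_run m c y y') =
  if c <= a < c + m then nth 0 (digit_diff m 1 y y') (a - c) else 0.
Proof.
elim: m c y y' => [|m IH] c y y'; first by rewrite /= addn0; case: ifP => //; lia.
rewrite digit_diffS digit_runS count_cat count_nseq IH mul1n /=.
have [->|ca] := eqVneq c a; first by rewrite leqnn ltnn subnn addnS ltnS leq_addr /=; lia.
rewrite addSnnS; case: (ltngtP c a) ca => // ca _ /=; rewrite mul0n add0n.
by rewrite -[a - c]prednK ?subn_gt0 // subnS.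
Qed.

Lemma count_block_digit y y' c : c <= p ->
  count_mem c (block y y') = nth 0 (digit_diff p.+1 1 y y') c.
Proof.
move=> cp; rewrite [LHS]/= count_cat count_nseq count_digit_run.
by rewrite leq0n add0n ltnS cp subn0 /=; do 2!case: eqP; lia.
Qed.

(** The text continued to an infinite sequence of blocks: windows become images of [iota], and the
    closing separator of the text is the first letter of the next block. *)
Definition letter (y : nat -> nat) (j : nat) : nat :=
  nth 0 (block (y (j %/ block_size)) (y (j %/ block_size).+1)) (j %% block_size).

Lemma letter_block y i :
  [seq letter y j | j <- iota (i * block_size) block_size] = block (y i) (y i.+1).
Proof.
apply: (@eq_from_nth _ 0); rewrite size_map size_iota ?size_block // => j jL.
rewrite (nth_map 0) ?size_iota // nth_iota // /letter.
by rewrite divnMDl // modnMDl divn_small // modn_small // addn0.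
Qed.

Lemma letter_blocks y i k :
  [seq letter y j | j <- iota (i * block_size) (k * block_size)] =
  flatten [seq block (y j) (y j.+1) | j <- iota i k].
Proof.
elim: k i => // k IH i.
by rewrite mulSn iotaD map_cat letter_block -mulSnr IH.
Qed.

Lemma letter_sep y j : (letter y j == p.+2) = (block_size %| j).
Proof.
rewrite /letter /dvdn; have := ltn_pmod j (ltn0Sn _ : 0 < block_size).
case: (_ %% _) => [|i] ji; first by rewrite /= !eqxx.
set b := block _ _; apply/negbTE; have : nth 0 b i.+1 \in behead b.
  rewrite /b [nth _ _ _]/= mem_nth //.
  by have := size_block (y (j %/ block_size)) (y (j %/ block_size).+1); rewrite /=; lia.
apply: contraTneq => ->; rewrite /b [behead _]/=.
rewrite mem_cat mem_nseq negb_or.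
have -> : (p.+2 == p.+1) = false by lia.
rewrite andbF andbT -has_pred1 has_count -leqNgt.
by rewrite count_digit_run; case: ifP => //; lia.
Qed.

Lemma textE n y : text n y =
  [seq letter y j | j <- iota 0 (n.-1 * block_size).+1].
Proof.
rewrite -addn1 iotaD map_cat -[X in iota X (_ * _)](mul0n block_size) letter_blocks.
by rewrite /= add0n /letter modnMl.
Qed.

Local Opaque block.

Lemma size_text n y : size (text n y) = (n.-1 * block_size).+1.
Proof. by rewrite textE size_map size_iota. Qed.

(** The digit differences of successive blocks telescope, and the closing separator adds nothing.
    The term [k * B] keeps truncated subtraction exact for [k > 0]; for [k = 0] both digits are the
    same. *)
Lemma count_window y i k c : c <= p ->
  count_mem c [seq letter y j | j <- iota (i * block_size) (k * block_size).+1] =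
  nth 0 (digit_diff p.+1 k (y i) (y (i + k))) c.
Proof.
move=> cp; rewrite -addn1 iotaD map_cat count_cat /=.
rewrite -mulnDl; have /eqP -> : letter y ((i + k) * block_size) == p.+2.
  by rewrite letter_sep dvdn_mull.
have -> : (p.+2 == c) = false by lia.
rewrite !addn0 letter_blocks; elim: k => [|k IH].
  by rewrite addn0 nth_digit_diff ?ltnS //= mul0n add0n subnn.
rewrite -[X in iota _ X]addn1 iotaD map_cat flatten_cat count_cat IH /= cats0.
rewrite count_block_digit // !nth_digit_diff ?ltnS // addnS.
have lt z : z %% B <= B by rewrite ltnW // ltn_pmod.
move: (lt (y i %/ B ^ c)) (lt (y (i + k) %/ B ^ c)) (lt (y (i + k).+1 %/ B ^ c)).
case: k {IH} => [|k]; first by rewrite addn0 mul0n mul1n; lia.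
rewrite !mulSn; move: (k * B) (_ %% B) (_ %% B) (_ %% B) => {lt cp}; lia.
Qed.

Lemma size_query_digits m u q k : size (query_digits m u q k) = m.+1.
Proof. by elim: m u q => //= m IH u q; rewrite IH. Qed.

(** Whatever [q] is, equality at one position says that the digits of [u] and [y] add up to the
    digit of [y'] plus [B] times the guessed bit, and that bit is passed on as a carry. Summing over
    the positions gives the equation, so a wrong guess never matches by accident. *)
Lemma query_digits_sound m u q k y y' : 0 < k -> y < B ^ m.+1 -> y' < B ^ m.+1 ->
  query_digits m u q k = digit_diff m.+1 k y y' -> u + y = B ^ m.+1 + y'.
Proof.
move=> k0; elim: m u q y y' => [|m IH] u q y y' yB y'B.
  rewrite digit_diffS /= => -[]; rewrite expn1 in yB y'B *.
  by rewrite !modn_small //; case: k k0 => // k _; rewrite mulSn /=; lia.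
rewrite digit_diffS /= => -[e1 /IH]; rewrite !ltn_divLR // -!expnSr yB y'B => /(_ isT isT).
move: e1; rewrite [in X in _ -> _ -> X](divn_eq u B) [in X in _ -> _ -> X](divn_eq y B).
rewrite [in X in _ -> _ -> X](divn_eq y' B) [B ^ m.+2]expnSr.
have := ltn_pmod u B_gt0; have := ltn_pmod y B_gt0; have := ltn_pmod y' B_gt0.
have : q %% 2 < 2 by rewrite ltn_pmod.
move: (B ^ m.+1) (y %% B) (y' %% B) (u %% B) (q %% 2).
move: (y %/ B) (y' %/ B) (u %/ B) => a a' v N b b' w r.
case: k k0 {IH} => // k _ r2 hb' hb hw e1 e2.
have {e1} : w + b = r * B + b'.
  by case: r r2 e1 {e2} => [|[|//]] _; rewrite ?subn0 ?subn1 /= ?mulSn; lia.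
by move: e2; lia.
Qed.

(** The right guess is the sequence of carries in the addition of [u] and [y]. The multiple
    [j * 2 ^ m] is never read, which allows one counter to hold both the index distance and the
    guess. *)
Lemma query_digits_complete m u k y y' : 0 < k -> u + y = B ^ m.+1 + y' ->
  y < B ^ m.+1 -> y' < B ^ m.+1 ->
  forall j, exists2 q, q < 2 ^ m &
    query_digits m u (j * 2 ^ m + q) k = digit_diff m.+1 k y y'.
Proof.
move=> k0; elim: m u y y' => [|m IH] u y y' e yB y'B j.
  exists 0 => //; rewrite digit_diffS /=; congr (_ :: _).
  rewrite expn1 in yB y'B e *.
  by rewrite !modn_small //; case: k k0 => // k _; rewrite mulSn /=; lia.
pose b := (u %% B + y %% B) %/ B.
have hu := ltn_pmod u B_gt0; have hy := ltn_pmod y B_gt0; have hy' := ltn_pmod y' B_gt0.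
have b2 : b < 2 by rewrite ltn_divLR // mul2n -addnn; lia.
have eb : u %% B + y %% B = b * B + y' %% B.
  rewrite [LHS](divn_eq _ B); congr (_ + _).
  by rewrite modnDm e expnSr modnMDl.
have e1 : u %/ B + b + y %/ B = B ^ m.+1 + y' %/ B.
  move: e; rewrite {1}(divn_eq u B) {1}(divn_eq y B) {1}(divn_eq y' B) expnSr.
  move: eb; move: (B ^ m.+1) (u %/ B) (y %/ B) (y' %/ B) => N v a a' eb e.
  by apply/eqP; rewrite -(eqn_pmul2r B_gt0) !mulnDl; apply/eqP; lia.
have [||q q_lt eq] := IH _ _ _ e1 _ _ j; [by rewrite ltn_divLR // -expnSr..|].
exists (q * 2 + b); first by rewrite expnSr; lia.
rewrite digit_diffS /=.
have -> : j * 2 ^ m.+1 + (q * 2 + b) = (j * 2 ^ m + q) * 2 + b.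
  by rewrite expnSr; lia.
rewrite modnMDl (modn_small b2) divnMDl // (divn_small b2) addn0 eq; congr (_ :: _).
move: eb hy; rewrite -/b; case: k k0 {eq IH} => // k _.
by case: b b2 {e1} => [|[|//]] _; rewrite ?subn0 ?subn1 /= ?mulSn; lia.
Qed.

(** The slack 2 makes the bound on [u] inductive: after division by [B >= 2] at most 1 of it is
    left, and the guessed carry adds at most 1. The result makes the subtraction in the filler entry
    of [query] exact. *)
Lemma sumn_query_digits m u q k : 0 < k -> u <= 2 * B ^ m.+1 + 2 ->
  sumn (query_digits m u q k) <= k * (3 * m.+1 * B).
Proof.
move=> k0; elim: m u q => [|m IH] u q hu /=.
  by rewrite expn1 in hu; case: k k0 => // k _ /=; rewrite mulSn; lia.
have hq : q %% 2 < 2 by rewrite ltn_pmod.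
have hB := ltn_pmod u B_gt0.
have : u %/ B + q %% 2 <= 2 * B ^ m.+1 + 2.
  have : u %/ B <= (2 * B ^ m.+1 * B + 2) %/ B by apply: leq_div2r; rewrite -mulnA -expnSr.
  have : 2 %/ B <= 1 by rewrite -[1](@divnn 2) leq_div2l.
  by rewrite divnMDl //; lia.
move=> /IH -/(_ (q %/ 2)).
have : (k - q %% 2) * B <= k * B by rewrite leq_mul2r leq_subr orbT.
have : B <= k * B by rewrite leq_pmull.
by rewrite -!mulnA !mulSn !mulnDr; lia.
Qed.

Lemma size_query u q k : size (query u q k) = p.+3.
Proof. by rewrite size_cat size_query_digits addn2. Qed.

Lemma nth_query_digits u q k c : c <= p ->
  nth 0 (query u q k) c = nth 0 (query_digits p u q k) c.
Proof. by move=> cp; rewrite nth_cat size_query_digits ltnS cp. Qed.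

Lemma nth_query_filler u q k : nth 0 (query u q k) p.+1 =
  k * block_size - k - sumn (query_digits p u q k).
Proof. by rewrite nth_cat size_query_digits ltnn subnn. Qed.

Lemma nth_query_sep u q k : nth 0 (query u q k) p.+2 = k.+1.
Proof. by rewrite nth_cat size_query_digits ltnNge leqnSn subSnn. Qed.

Lemma sumn_query u q k : 0 < k -> u <= 2 * B ^ p.+1 + 2 ->
  sumn (query u q k) = (k * block_size).+1.
Proof.
move=> k0 /(sumn_query_digits q k0) h.
by rewrite sumn_cat /= /block_size mulnS; lia.
Qed.

End Encoding.

Lemma sum_count_mem (T : finType) (s : seq T) : \sum_i count_mem i s = size s.
Proof.
elim: s => [|a s IH] /=; first by rewrite big1.
rewrite big_split /= IH (bigD1 a) //= eqxx big1 // => i /negbTE.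
by rewrite eq_sym => ->.
Qed.

Lemma count_map_val n (s : seq 'I_n) (i : 'I_n) :
  count_mem (val i) [seq val a | a <- s] = count_mem i s.
Proof. by rewrite count_map; apply: eq_count => a; rewrite /= val_eqE. Qed.

(** * Soundness and completeness of the queries on the text *)

Section Jumbled.
Variables (p B : nat).
Hypothesis B_gt1 : 1 < B.

Definition query_tuple (u q k : nat) : p.+3.-tuple nat :=
  [tuple nth 0 (query p B u q k) i | i < p.+3].

Lemma text_tuple_subproof n y :
  size [seq inord a : 'I_p.+3 | a <- text p B n y] == (n.-1 * block_size p B).+1.
Proof. by rewrite size_map size_text. Qed.

Definition text_tuple n y : (n.-1 * block_size p B).+1.-tuple 'I_p.+3 :=
  Tuple (text_tuple_subproof n y).

Lemma text_lt n y a : a \in text p B n y -> a < p.+3.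
Proof.
rewrite mem_cat inE => /orP[/flattenP[s /mapP[i _ ->]]|/eqP -> //].
rewrite inE mem_cat mem_nseq => /or3P[/eqP ->|h|/andP[_ /eqP ->]] //.
move: h; rewrite -has_pred1 has_count count_digit_run //.
by case: ifP => // /andP[_]; lia.
Qed.

Lemma val_text_tuple n y : [seq val a | a <- text_tuple n y] = text p B n y.
Proof.
rewrite /= -map_comp map_id_in // => a /text_lt a_lt /=.
by rewrite inordK.
Qed.

Lemma parikhP (s : seq 'I_p.+3) u q k :
  parikh s = query_tuple u q k <->
  forall c, c < p.+3 -> count_mem c [seq val a | a <- s] = nth 0 (query p B u q k) c.
Proof.
split=> [e c c_lt|H].
  have := congr1 (fun t => tnth t (Ordinal c_lt)) e.
  by rewrite !tnth_mktuple -count_map_val.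
by apply: eq_from_tnth => i; rewrite !tnth_mktuple -count_map_val H // ltn_ord.
Qed.

Lemma jumbled_occurs_sound n y u q k : 0 < k -> u <= 2 * B ^ p.+1 + 2 ->
  (forall i, y i < B ^ p.+1) ->
  jumbled_occurs (text_tuple n y) (query_tuple u q k) ->
  exists2 i, i + k < n & u + y i = B ^ p.+1 + y (i + k).
Proof.
move=> k0 hu yB [S [/infixP[S1 [S2 eS]] /[dup] eP /parikhP hP]].
(* The length of the substring is the sum of its Parikh vector. *)
have sz : size S = (k * block_size p B).+1.
  rewrite -(sumn_query B_gt1 q k0 hu) -sum_count_mem sumnE (big_nth 0) size_query.
  by rewrite big_mkord; apply: eq_bigr => i _; rewrite -hP // count_map_val.
have := val_text_tuple n y; rewrite eS !map_cat textE //.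
set a := size S1; set N := (_ * _).+1 => eT.
have szN : a + ((k * block_size p B).+1 + size S2) = N.
  by rewrite -sz -!size_cat -eS size_tuple.
have es : [seq val i | i <- S] = [seq letter p B y j | j <- iota a (k * block_size p B).+1].
  move: eT; rewrite -szN !iotaD add0n !map_cat => /eqP.
  rewrite eqseq_cat ?size_map ?size_iota // => /andP[_].
  by rewrite eqseq_cat ?size_map ?size_iota // => /andP[/eqP].
(* The number of separators forces the start [a] to be a multiple of the block size; the digit
   letters can then be read off by [count_window]. *)
have : count_mem p.+2 [seq val i | i <- S] = k.+1 by rewrite hP // nth_query_sep.
rewrite es count_map (eq_count (letter_sep p B_gt1 y)) count_multiples // -addn1 => /addnI.
case: dvdnP => // -[i ea] _; exists i.
  move: szN; rewrite /N ea => szN.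
  have : (i + k) * block_size p B <= n.-1 * block_size p B by lia.
  by rewrite leq_pmul2r //; lia.
apply: (query_digits_sound B_gt1 (q := q) k0) => //.
apply: (@eq_from_nth _ 0); rewrite size_query_digits ?size_mkseq // => c; rewrite ltnS => cp.
rewrite -nth_query_digits // -hP; last by lia.
by rewrite es ea count_window.
Qed.

Lemma jumbled_occurs_complete n y u k i : 0 < k -> u <= 2 * B ^ p.+1 + 2 ->
  (forall i, y i < B ^ p.+1) -> i + k < n -> u + y i = B ^ p.+1 + y (i + k) ->
  forall j, exists2 q, q < 2 ^ p &
    jumbled_occurs (text_tuple n y) (query_tuple u (j * 2 ^ p + q) k).
Proof.
move=> k0 hu yB ikn e j.
have [q q_lt eq] := query_digits_complete B_gt1 k0 e (yB _) (yB _) j.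
exists q => //; set Q := j * _ + q in eq *.
(* The witness consists of the blocks [i] to [i + k - 1] and the separator after them. *)
pose s := [seq letter p B y j | j <- iota (i * block_size p B) (k * block_size p B).+1].
pose S := [seq inord a : 'I_p.+3 | a <- s].
have [s1 [s2 [eT]]] : exists s1 s2, text p B n y = s1 ++ s ++ s2 /\ True.
  rewrite textE // /s.
  have -> : (n.-1 * block_size p B).+1 = i * block_size p B +
     ((k * block_size p B).+1 + (n.-1 - (i + k)) * block_size p B).
    by rewrite addSn addnS -!mulnDl addnA subnKC //; lia.
  by rewrite !iotaD add0n !map_cat; do 2!eexists.
move=> _; have vS : [seq val a | a <- S] = s.
  rewrite -map_comp map_id_in // => a as_ /=; rewrite inordK //.
  by apply: (@text_lt n y); rewrite eT !mem_cat as_ orbT.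
exists S; split.
  apply/infixP; exists [seq inord a | a <- s1], [seq inord a | a <- s2].
  by rewrite /= eT !map_cat.
have digits c : c <= p -> count_mem c s = nth 0 (query p B u Q k) c.
  by move=> cp; rewrite count_window // nth_query_digits // eq.
have sep : count_mem p.+2 s = k.+1.
  by rewrite count_map (eq_count (letter_sep p B_gt1 y)) count_multiples // dvdn_mull // addn1.
have sS : size S = (k * block_size p B).+1 by rewrite !size_map size_iota.
clearbody s S; apply/parikhP => c; rewrite vS ltnS leq_eqVlt => /predU1P[->|].
  by rewrite nth_query_sep.
rewrite ltnS leq_eqVlt => /predU1P[->|]; last exact: digits.
(* The filler is not counted directly: all other entries agree, and so do the totals. *)
have := sum_count_mem S; rewrite sS.
under eq_bigr => a _ do rewrite -count_map_val vS.
rewrite !big_ord_recr /= sep digits // (eq_bigr (fun a : 'I_p => nth 0 (query p B u Q k) a)); last first.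
  by move=> a _; rewrite digits 1?ltnW.
have := sumn_query B_gt1 Q k0 hu; rewrite sumnE (big_nth 0) size_query big_mkord.
rewrite !big_ord_recr /= nth_query_sep => <-.
by move/eqP; rewrite eqn_add2r eqn_add2l => /eqP.
Qed.

End Jumbled.

(** * The reduction as a program *)

(** Register 1 is left out, being the scratch register of the simulation. Register 0 holds the input
    length, which is also the displacement of the simulated memory. Registers are reused: in the
    query phase [rX] holds [B ^ p.+1 - n ^ 2], [rV] the number [2 ^ p], [rQ] the counter of queries,
    [rK] the index distance and [rP] the unread guess bits. *)
Local Notation rN := 0.
Local Notation rB := 2.
Local Notation rP := 3.
Local Notation rL := 4.
Local Notation r1 := 5.
Local Notation rI := 6.
Local Notation rPtr := 7.
Local Notation rU := 8.
Local Notation rV := 9.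
Local Notation rCnt := 10.
Local Notation rX := 11.
Local Notation rY := 12.
Local Notation rQ := 13.
Local Notation rK := 14.
Local Notation rAcc := 15.

Local Arguments digit_run : simpl never.

Definition power_code (m : nat) : seq instr :=
  Const rP 1 :: nseq m (Binop OpMul rP rP rB).

(** Linear search for the base, starting from 2. It makes fewer than [B] passes, which is cheap
    compared with writing a text of about [n * B] letters. *)
Definition base_code (m : nat) : cmd :=
  Seq (Basic ([:: Const r1 1; Binop OpMul rX rN rN; Binop OpAdd rX rX rX;
                  Binop OpAdd rX rX r1; Const rB 2]
              ++ power_code m ++ [:: Binop OpLt rI rP rX]))
      (While rI (Basic (Binop OpAdd rB rB r1 :: power_code m ++ [:: Binop OpLt rI rP rX]))).

Definition fill_code : cmd :=
  While rCnt (Basic [:: Write rPtr rY; Binop OpAdd rPtr rPtr r1; Binop OpSub rCnt rCnt r1]).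

Fixpoint digit_code (m c : nat) : cmd :=
  if m is m'.+1 then
    Seq (Basic [:: Const rY c; Binop OpMod rCnt rU rB; Binop OpAdd rCnt rCnt rB;
                   Binop OpMod rQ rV rB; Binop OpSub rCnt rCnt rQ; Binop OpSub rAcc rAcc rCnt;
                   Binop OpDiv rU rU rB; Binop OpDiv rV rV rB])
        (Seq fill_code (digit_code m' c.+1))
  else Basic [::].

Definition block_code (m : nat) : cmd :=
  Seq (Basic [:: Write rPtr rX; Binop OpAdd rPtr rPtr r1; Read rV rK;
                 Binop OpAdd rK rK r1; Read rU rK; Binop OpSub rAcc rL r1])
  (Seq (digit_code m 0)
  (Seq (Basic [:: Const rY m; Move rCnt rAcc])
  (Seq fill_code
       (Basic [:: Binop OpSub rI rI r1])))).

(** The text is written directly behind the input, that is from address 0 of the simulated memory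
    on, and its length goes to simulated register 0: the preprocessing program finds its start
    configuration. *)
Definition text_code (m : nat) : cmd :=
  Seq (Basic [:: Const rL (3 * m); Binop OpMul rL rL rB; Binop OpAdd rL rL r1;
                 Const rX m.+1; Const rK 0; Move rPtr rN; Binop OpSub rI rN r1])
  (Seq (While rI (block_code m))
       (Basic [:: Write rPtr rX; Binop OpAdd rPtr rPtr r1; Binop OpSub (sreg 0) rPtr rN])).

Fixpoint query_code (m c : nat) : seq instr :=
  if m is m'.+1 then
    [:: Const rY 2; Binop OpMod rPtr rP rY; Binop OpDiv rP rP rY;
        Binop OpSub rY rK rPtr; Binop OpMul rY rY rB;
        Binop OpMod (sreg c) rU rB; Binop OpAdd (sreg c) rY (sreg c);
        Binop OpDiv rU rU rB; Binop OpAdd rU rU rPtr;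
        Binop OpSub rCnt rCnt (sreg c)] ++ query_code m' c.+1
  else
    [:: Binop OpSub rY rK r1; Binop OpMul rY rY rB; Binop OpAdd (sreg c) rY rU;
        Binop OpSub rCnt rCnt (sreg c); Move (sreg c.+1) rCnt].

(** The quotient of the counter [rQ] by [2 ^ p] is the index distance, its remainder the guess.
    Answers are only collected by a disjunction in [rAcc]; the course of the loop does not depend on
    them. *)
Definition query_step (p : nat) (query : program) : cmd :=
  Seq (Basic ([:: Binop OpDiv rK rQ rV; Binop OpSub rU rK r1; Read rU rU;
                  Binop OpAdd rU rU rX; Binop OpMul rCnt rK rL; Binop OpSub rCnt rCnt rK;
                  Binop OpAdd (sreg p.+2) rK r1; Move rP rQ] ++ query_code p 0))
  (Seq (Sim query)
       (Basic [:: Binop OpOr rAcc rAcc (sreg 0); Binop OpAdd rQ rQ r1; Binop OpSub rI rI r1])).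

Definition queries_code (p : nat) (query : program) : cmd :=
  Seq (Basic [:: Binop OpMul rX rN rN; Binop OpSub rX rP rX; Const rV (2 ^ p);
                 Move rQ rV; Binop OpSub rI rN r1; Binop OpMul rI rI rV; Const rAcc 0])
  (Seq (While rI (query_step p query))
       (Basic [:: Move 0 rAcc])).

Definition reduction (p : nat) (pre query : program) : cmd :=
  Seq (base_code p.+1) (Seq (text_code p.+1) (Seq (Sim pre) (queries_code p query))).

(** * Correctness and running time of the parts of the reduction *)

Definition same_regs (s : seq nat) (k k' : config) : Prop :=
  (forall i, i \notin s -> regs k' i = regs k i) /\ tape k' = tape k.

(** Memory contents are described by lists padded with 0, so that writing at address [size l] is
    appending. *)
Lemma upd_nth_size (l : seq nat) v : upd (nth 0 l) (size l) v = nth 0 (rcons l v).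
Proof.
apply: funext => i; rewrite /upd nth_rcons.
by case: ltngtP => // il; rewrite nth_default // ltnW.
Qed.

Lemma setr_setr k a v v' : setr (setr k a v) a v' = setr k a v'.
Proof.
by rewrite /setr /=; congr Config; apply: funext => i; rewrite /upd; case: eqP.
Qed.

Lemma regs_setr k a v b : regs (setr k a v) b = if b == a then v else regs k b.
Proof. by []. Qed.

Lemma regs_setm k a v b : regs (setm k a v) b = regs k b.
Proof. by []. Qed.

Lemma memory_setr k a v : memory (setr k a v) = memory k.
Proof. by []. Qed.

Lemma memory_setm k a v b :
  memory (setm k a v) b = if b == a then v else memory k b.
Proof. by []. Qed.

Lemma tape_setr k a v : tape (setr k a v) = tape k.
Proof. by []. Qed.

Lemma tape_setm k a v : tape (setm k a v) = tape k.
Proof. by []. Qed.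

Definition configE :=
  (regs_setr, regs_setm, memory_setr, memory_setm, tape_setr, tape_setm).

Lemma rcons_nseq (T : Type) n (x : T) : rcons (nseq n x) x = nseq n.+1 x.
Proof. by elim: n => //= n ->. Qed.

Section Execution.
Variable w : nat.
Local Notation wp := (wp w).

Lemma wp_Const d v l (Q : config -> Prop) k : v < 2 ^ w -> wp l Q (setr k d v) -> wp (Const d v :: l) Q k.
Proof. by []. Qed.

Lemma wp_Move d a l (Q : config -> Prop) k v : regs k a = v -> v < 2 ^ w -> wp l Q (setr k d v) ->
  wp (Move d a :: l) Q k.
Proof. by move=> <-. Qed.

Lemma wp_Binop o d a b l (Q : config -> Prop) k va vb : regs k a = va -> regs k b = vb ->
  eval_op o va vb < 2 ^ w -> wp l Q (setr k d (eval_op o va vb)) ->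
  wp (Binop o d a b :: l) Q k.
Proof. by move=> <- <-. Qed.

Lemma wp_Read d a l (Q : config -> Prop) k v u : regs k a = v -> memory k v = u -> v < 2 ^ w -> u < 2 ^ w ->
  wp l Q (setr k d u) -> wp (Read d a :: l) Q k.
Proof. by move=> <- <-. Qed.

End Execution.

(* Unfolding [wp] on a whole block duplicates the configuration at every
   instruction, hence terms of exponential size; [rd] computes the operands
   before the next instruction is executed. *)
Ltac exec rd :=
  lazymatch goal with
  | |- wp _ (Const _ _ :: _) _ _ => apply: wp_Const
  | |- wp _ (Move _ _ :: _) _ _ => eapply wp_Move; [rd | |]
  | |- wp _ (Binop _ _ _ _ :: _) _ _ =>
      eapply wp_Binop; [rd | rd | cbn [eval_op] | cbn [eval_op]]
  | |- wp _ (Read _ _ :: _) _ _ => eapply wp_Read; [rd | rd | | |]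
  end.

Section Program.
Variables (w : nat) (xi : nat -> bool).
Local Notation ends_within := (ends_within w xi).
Local Notation wp := (wp w).

Lemma wp_power m rest (Q : config -> Prop) k b : 0 < b -> 1 < 2 ^ w -> b ^ m < 2 ^ w -> regs k rB = b ->
  wp rest Q (setr k rP (b ^ m)) -> wp (power_code m ++ rest) Q k.
Proof.
move=> b0 w1 bm kb H; split=> //.
suff P j i : b ^ (j + i) < 2 ^ w -> wp rest Q (setr k rP (b ^ (j + i))) ->
    wp (nseq i (Binop OpMul rP rP rB) ++ rest) Q (setr k rP (b ^ j)).
  by apply: (P 0 m); rewrite add0n.
elim: i j => [|i IH] j; first by rewrite addn0.
rewrite -addSnnS => bj /(IH _ bj) H'; rewrite /= {1 3}/upd /= {1 2}/upd /= kb.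
rewrite -expnSr setr_setr; split=> //.
by apply: leq_ltn_trans bj; rewrite leq_pexp2l // leq_addr.
Qed.

Lemma ends_within_fill l v cnt k (Q : config -> Prop) :
  2 <= 2 ^ w -> size l + cnt < 2 ^ w -> v < 2 ^ w ->
  memory k = nth 0 l -> regs k rPtr = size l -> regs k rY = v -> regs k rCnt = cnt ->
  regs k r1 = 1 ->
  (forall k', same_regs [:: rPtr; rCnt] k k' -> memory k' = nth 0 (l ++ nseq cnt v) ->
     regs k' rPtr = size l + cnt -> Q k') ->
  ends_within fill_code (5 * cnt + 1) Q k.
Proof.
move=> w2 hl hv km kp ky kc k1 HQ.
pose I j k' := [/\ same_regs [:: rPtr; rCnt] k k', memory k' = nth 0 (l ++ nseq j v),
  regs k' rPtr = size l + j & regs k' rCnt = cnt - j].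
apply: (@ends_within_mono _ _ _ (\sum_(j < cnt) 5).+1 _ (I cnt)).
- by rewrite sum_nat_const card_ord; lia.
- by move=> k' [f' m' p' _]; apply: HQ.
apply: (@ends_within_While _ _ _ _ _ (fun=> 3)).
- by move=> j k' jc [_ _ _ ->]; rewrite -lt0n subn_gt0.
- by move=> k' [_ _ _ ->]; rewrite subnn.
- move=> j k' jc [[f ft] m' p' c'].
  have [y1 o1] : regs k' rY = v /\ regs k' r1 = 1 by rewrite !f.
  apply: ends_within_Basic => //; rewrite /= /setr /setm /upd /= p' y1 c' o1.
  split; [lia|lia|split; [lia|split; [lia|split]]]; rewrite /= ?addn1 ?addnS //; last by lia.
  + by split=> //= i; rewrite !inE negb_or => /andP[i1 i2]; rewrite !ifN // f // !inE negb_or i1.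
  + have sz : size (l ++ nseq j v) = size l + j by rewrite size_cat size_nseq.
    rewrite m' -sz -[LHS]/(upd (nth 0 (l ++ nseq j v)) (size (l ++ nseq j v)) v) upd_nth_size.
    by rewrite rcons_cat rcons_nseq.
- by split; rewrite ?cats0 ?addn0 ?subn0.
Qed.


(** A digit costs eight instructions and the last test of the filling loop, a letter five steps.
    [rAcc] is decreased by the number of letters written, so that it finally holds the amount of
    filler. *)
Lemma ends_within_digits B m c y y' a l k (Q : config -> Prop) :
  1 < B -> size l + size (digit_run B m c y y') < 2 ^ w -> c + m < 2 ^ w -> 2 * B < 2 ^ w ->
  y < 2 ^ w -> y' < 2 ^ w -> a < 2 ^ w ->
  memory k = nth 0 l -> regs k rPtr = size l -> regs k rB = B -> regs k r1 = 1 ->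
  regs k rV = y -> regs k rU = y' -> regs k rAcc = a ->
  (forall k', same_regs [:: rPtr; rU; rV; rCnt; rY; rQ; rAcc] k k' ->
     memory k' = nth 0 (l ++ digit_run B m c y y') ->
     regs k' rPtr = size l + size (digit_run B m c y y') ->
     regs k' rAcc = a - size (digit_run B m c y y') -> Q k') ->
  ends_within (digit_code m c) (9 * m + 5 * size (digit_run B m c y y')) Q k.
Proof.
move=> B1; elim: m c y y' a l k => [|m IH] c y y' a l k.
  move=> _ _ _ _ _ _ km kp _ _ _ _ ka HQ; apply: ends_within_Basic => //=.
  by apply: HQ; rewrite /= ?cats0 ?addn0 ?subn0.
rewrite digit_runS size_cat size_nseq; set N := B + y' %% B - y %% B.
move=> hl hc hB hy hy' ha km kp kB k1 ky ky' ka HQ.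
have lt z : z %% B < B by rewrite ltn_pmod // ltnW.
have hN : N <= 2 * B by rewrite /N; have := lt y'; lia.
have dv z : z < 2 ^ w -> z %/ B < 2 ^ w by apply: leq_ltn_trans; exact: leq_div.
apply: (@ends_within_Seq _ _ _ _ 8 (5 * N + 1 + (9 * m + 5 * size (digit_run B m c.+1 (y %/ B) (y' %/ B))))).
  by lia.
apply: ends_within_Basic => //.
have e0 : y' %% B + B - y %% B = N by rewrite /N addnC.
have h1 := lt y; have h2 := lt y'.
do 8!(exec ltac:(rewrite !configE /= ?kB ?ky ?ky' ?ka; reflexivity); rewrite ?e0;
  first by [lia|exact: dv]).
apply: (@ends_within_Seq _ _ _ _ (5 * N + 1) _ _ _ _ (leqnn _)).
apply: (@ends_within_fill l c N) => //=; try lia.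
move=> k' [f ft] m' p'.
have {}f i : i \notin [:: rPtr; rCnt] -> regs k' i = _ := f i.
apply: (IH c.+1 (y %/ B) (y' %/ B) (a - N) (l ++ nseq N c)); rewrite ?size_cat ?size_nseq ?p' ?f //=.
all: try by [exact: dv|lia].
move=> k2 [f2 ft2] m2 p2 a2; apply: HQ; rewrite ?catA ?addnA ?subnDA //.
split; last by rewrite ft2 ft.
move=> i hi; rewrite f2 // f.
  rewrite !configE; move: hi; rewrite !inE !negb_or => /and5P[? ? ? ? /and3P[? ? ?]].
  by rewrite !ifN.
by move: hi; rewrite !inE !negb_or => /and5P[-> _ _ -> _].
Qed.

Local Arguments digit_code : simpl never.

(** [l] is the input followed by the blocks already written; the values [y] and [y'] are read from
    its initial part, hence [j.+1 < size l]. *)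
Lemma ends_within_block B p y y' j N l k (Q : config -> Prop) :
  1 < B -> size l + block_size p B < 2 ^ w -> 2 * B < 2 ^ w -> p.+3 < 2 ^ w ->
  y < 2 ^ w -> y' < 2 ^ w ->
  memory k = nth 0 l -> nth 0 l j = y -> nth 0 l j.+1 = y' -> j.+1 < size l ->
  regs k rPtr = size l -> regs k rB = B -> regs k r1 = 1 -> regs k rL = block_size p B ->
  regs k rX = p.+2 -> regs k rK = j -> regs k rI = N -> N < 2 ^ w ->
  (forall k',
     same_regs [:: rI; rPtr; rU; rV; rCnt; rY; rQ; rK; rAcc] k k' ->
     memory k' = nth 0 (l ++ block p B y y') ->
     regs k' rPtr = size l + block_size p B -> regs k' rK = j.+1 -> regs k' rI = N.-1 ->
     Q k') ->
  ends_within (block_code p.+1) (9 * p + 20 + 5 * block_size p B) Q k.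
Proof.
move=> B1 hl hB hp hy hy' km ly ly' lj kp kB k1 kL kX kK kI hN HQ.
set D := digit_run B p.+1 0 y y'.
have sD : size D <= 3 * p.+1 * B.
  by apply: leq_trans (size_digit_run B1 _ _ _ _) _; rewrite -!mulnA leq_mul2r orbT.
have bsE : block_size p B = (3 * p.+1 * B).+1 by [].
pose F := 3 * p.+1 * B - size D.
apply: (@ends_within_Seq _ _ _ _ 6 (9 * p.+1 + 5 * size D + (2 + (5 * F + 1 + 1)))).
  by rewrite /F bsE; lia.
apply: ends_within_Basic => //; rewrite /= /setr /setm /upd /= kp k1 kK km kX kL.
rewrite !ifN; [|lia..].
rewrite !addn1 ly ly'.
split; [lia..|split; first by lia].
split; [lia|lia|].
split; first by lia.
split; [lia|lia|].
split; first by lia.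
apply: (@ends_within_Seq _ _ _ _ (9 * p.+1 + 5 * size D) _ _ _ _ (leqnn _)).
apply: (@ends_within_digits B _ _ y y' (3 * p.+1 * B) (rcons l p.+2)); rewrite ?size_rcons //= -/D; try lia.
- by rewrite -upd_nth_size.
move=> k' [f ft] m' p' a'.
apply: (@ends_within_Seq _ _ _ _ 2 _ _ _ _ (leqnn _)).
apply: ends_within_Basic => //; rewrite /= /setr /setm /upd /= a'.
split; first by lia.
split; first by lia.
apply: (@ends_within_Seq _ _ _ _ (5 * F + 1) 1); first by lia.
have szl : (size l).+1 + size D = size (rcons l p.+2 ++ D) by rewrite size_cat size_rcons.
apply: (@ends_within_fill (rcons l p.+2 ++ D) p.+1 F) => //=; rewrite -?szl ?p' ?f //=; try by rewrite /F; lia.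
move=> k2 [f2 ft2] m2 p2.
apply: ends_within_Basic => //; rewrite /= /setr /setm /upd /=.
have e6 : regs k2 rI = N by rewrite f2 //= f.
have e1 : regs k2 r1 = 1 by rewrite f2 //= f.
rewrite e6 e1; split; first by lia.
apply: HQ => //=.
- split; last by rewrite /= ft2 /= ft.
  move=> i hi; move: (hi); rewrite /= !inE !negb_or => /and5P[i1 i2 i3 i4 /and5P[i5 i6 i7 i8 i9]].
  by rewrite ifN // f2 ?inE ?negb_or ?i2 //= !ifN // f ?inE ?negb_or ?i2 ?i3 ?i4 ?i5 ?i6 ?i7 ?i9 //= !ifN.
- by rewrite m2 /block -cats1 -!catA.
- by rewrite p2 /F bsE; lia.
- by rewrite f2 //= f.
- by rewrite subn1.
Qed.

Lemma size_power_code m : size (power_code m) = m.+1.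
Proof. by rewrite /= size_nseq. Qed.

Local Opaque power_code.

Lemma ends_within_base m B n k (Q : config -> Prop) :
  0 < m -> 1 < B -> 2 * n ^ 2 < B ^ m -> (forall b, 1 < b < B -> b ^ m <= 2 * n ^ 2) ->
  2 * n ^ 2 + 1 < 2 ^ w -> B < 2 ^ w -> B ^ m < 2 ^ w -> regs k rN = n ->
  (forall k', same_regs [:: rB; rP; r1; rI; rX] k k' -> memory k' = memory k ->
     regs k' rB = B -> regs k' rP = B ^ m -> regs k' r1 = 1 -> Q k') ->
  ends_within (base_code m) (m + 8 + B * (m + 5)) Q k.
Proof.
move=> m0 B1 hB least hn hBw hP kn HQ; rewrite -mulnn in hB least hn.
set X := n * n + n * n + 1.
have XE : X = 2 * (n * n) + 1 by rewrite /X; lia.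
have w1 : 1 < 2 ^ w by lia.
(* After [j] passes the candidate base is [2 + j], so [B - 2] passes are made. [rX] holds
   [2 * n ^ 2 + 1], which turns the strict comparison of the machine into [<=]. *)
pose I j k' := [/\ same_regs [:: rB; rP; r1; rI; rX] k k', memory k' = memory k,
  regs k' rB = 2 + j, regs k' rP = (2 + j) ^ m
  & [/\ regs k' r1 = 1, regs k' rX = X & regs k' rI = ((2 + j) ^ m < X) :> nat]].
have bw j : j <= B - 2 -> (2 + j) ^ m < 2 ^ w.
  by move=> jB; apply: leq_ltn_trans hP; rewrite leq_exp2r //; lia.
apply: (@ends_within_Seq _ _ _ _ (m + 7) (\sum_(j < B - 2) (m + 3).+2).+1).
  by rewrite sum_nat_const card_ord; nia.
- apply: ends_within_Basic; first by rewrite /= size_cat size_power_code /=; lia.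
  rewrite /= /setr /setm /upd /= kn; split; first by lia.
  split; first by lia.
  split; first by lia.
  split; first by lia.
  split; first by lia.
  apply: (@wp_power _ _ _ _ 2) => //; first exact: (bw 0).
  rewrite /= /setr /setm /upd /=; split; first exact: leq_ltn_trans (leq_b1 _) w1.
  apply: (@ends_within_mono _ _ _ _ _ (I (B - 2))); first exact: leqnn; last first.
    apply: (@ends_within_While _ _ _ _ _ (fun=> m + 3)).
    + move=> j k' jB [_ _ _ _ [_ _ ->]]; rewrite XE addn1 ltnS least //; lia.
    + move=> k' [_ _ _ _ [_ _ ->]]; rewrite subnKC // XE addn1 ltnS.
      by rewrite leqNgt hB.
    + move=> j k' jB [[f ft] m' rb rp [ro rx ri]].
      apply: ends_within_Basic; first by rewrite /= size_cat size_power_code /=; lia.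
      rewrite /= /setr /setm /upd /= rb ro; split; first by lia.
      apply: (@wp_power _ _ _ _ (2 + j.+1)); rewrite /= ?addn1 ?addnS //; first exact: (bw j.+1).
      rewrite /= /setr /setm /upd /= rx; split; first exact: leq_ltn_trans (leq_b1 _) w1.
      split=> //=; split=> // i; rewrite !inE !negb_or => /and5P[? ? ? ? ?] /=.
      by rewrite !ifN // f // !inE !negb_or; repeat (apply/andP; split).
    + split=> //=; split=> // i; rewrite !inE !negb_or => /and5P[? ? ? ? ?] /=.
      by rewrite !ifN.
  move=> k' [s' m' rb rp [ro _ _]]; apply: HQ => //; rewrite ?rb ?rp subnKC //.
Qed.

Local Opaque block.

Lemma ends_within_text B p n inp k (Q : config -> Prop) :
  1 < B -> size inp = n -> (forall i, nth 0 inp i < 2 ^ w) ->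
  n + n.-1 * block_size p B + 2 + p < 2 ^ w -> block_size p B + 1 < 2 ^ w ->
  memory k = nth 0 inp -> regs k rN = n -> regs k rB = B -> regs k r1 = 1 ->
  (forall k', same_regs [:: rL; rI; rPtr; rU; rV; rCnt; rX; rY; rQ; rK; rAcc; sreg 0] k k' ->
     memory k' = nth 0 (inp ++ text p B n (nth 0 inp)) -> regs k' rL = block_size p B ->
     regs k' (sreg 0) = (n.-1 * block_size p B).+1 -> Q k') ->
  ends_within (text_code p.+1) (11 + n * (9 * p + 22 + 5 * block_size p B)) Q k.
Proof.
move=> B1 si hy hb hL km kn kB k1 HQ.
have bsE : block_size p B = (3 * p.+1 * B).+1 by [].
pose y := nth 0 inp.
pose out j := flatten [seq block p B (y i) (y i.+1) | i <- iota 0 j].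
have szo j : size (out j) = j * block_size p B.
  elim: j => // j IH; rewrite /out -addn1 iotaD map_cat flatten_cat size_cat -/(out j) IH /=.
  by rewrite size_cat size_block // addn0 mulnDl mul1n.
pose I j k' := [/\ same_regs [:: rL; rI; rPtr; rU; rV; rCnt; rX; rY; rQ; rK; rAcc] k k',
  memory k' = nth 0 (inp ++ out j), regs k' rL = block_size p B, regs k' rX = p.+2
  & [/\ regs k' rK = j, regs k' rI = n.-1 - j & regs k' rPtr = n + j * block_size p B]].
apply: (@ends_within_Seq _ _ _ _ 7 ((\sum_(j < n.-1) (9 * p + 20 + 5 * block_size p B).+2).+1 + 3)).
  rewrite sum_nat_const card_ord.
  have : n.-1 * (9 * p + 20 + 5 * block_size p B).+2 <= n * (9 * p + 22 + 5 * block_size p B).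
    by apply: leq_mul; lia.
  by move=> {I hy hb}; lia.
apply: ends_within_Basic => //; rewrite /= /setr /setm /upd /= kB k1 kn.
have hbs : 3 * p.+1 * B + 2 < 2 ^ w by move: hL; rewrite bsE; lia.
have h3 : 3 * p.+1 <= 3 * p.+1 * B by rewrite leq_pmulr // ltnW.
split; first by lia.
split; first by lia.
split; first by lia.
split; first by lia.
split; first by lia.
split; first by lia.
split; first by lia.
apply: (@ends_within_Seq _ _ _ _ _ 3 _ _ _ (leqnn _)).
apply: (@ends_within_mono _ _ _ _ _ (I n.-1)); first exact: leqnn; last first.
  apply: (@ends_within_While _ _ _ _ _ (fun=> 9 * p + 20 + 5 * block_size p B)).

  - by move=> j k' jn [_ _ _ _ [_ -> _]]; rewrite -lt0n subn_gt0.
  - by move=> k' [_ _ _ _ [_ -> _]]; rewrite subnn.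
  - move=> j k' jn [[f ft] m' l' x' [kk' i' p']].
    have jb : j.+1 * block_size p B <= n.-1 * block_size p B by rewrite leq_mul2r jn orbT.
    have szl : size (inp ++ out j) = n + j * block_size p B by rewrite size_cat si szo.
    have nthl i : i < n -> nth 0 (inp ++ out j) i = y i by rewrite nth_cat si => ->.
    rewrite mulSn in jb.
    apply: (@ends_within_block B p (y j) (y j.+1) j (n.-1 - j) (inp ++ out j)) => //.
    all: rewrite ?szl ?nthl ?x' ?p' ?l' ?kk' ?i' ?f ?kB ?k1 //; try by [exact: hy|lia].
    move=> k2 [f2 ft2] m2 p2 kk2 i2; split.
    + split=> [i hi|]; last by rewrite ft2.
      rewrite f2 ?f //; move: hi; rewrite !inE !negb_or.
      by move=> /and5P[? -> -> -> /and5P[-> -> ? -> /and3P[-> -> ->]]].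
    + by rewrite m2 -catA /out -[X in _ ++ flatten (map _ (iota 0 X))]addn1 iotaD map_cat flatten_cat /= cats0.
    + by rewrite f2.
    + by rewrite f2.
    + by rewrite kk2 i2 p2 mulSn subnS; split=> //; rewrite -addnA [_ * _ + _]addnC.
  - split=> //=; last by rewrite subn1 subn0 mul0n addn0.
    + split=> // i; rewrite !inE !negb_or.
      by move=> /and5P[? ? ? ? /and5P[? ? ? ? /and3P[? ? ?]]] /=; rewrite !ifN.
    + by rewrite cats0.
    + by rewrite addn1 bsE.
move=> k' [[f ft] m' l' x' [kk' i' p']].
apply: ends_within_Basic => //; rewrite /= /setr /setm /upd /= p' x' !f //= k1 kn.
split; first by lia.
  by lia.
split; first by lia.
split; first by lia.
apply: HQ => //=.
- split=> // i; rewrite /= !inE !negb_or.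
  by move=> /and5P[? ? ? ? /and5P[? ? ? ? /and4P[? ? ? ?]]]; rewrite !ifN // f // !inE !negb_or; repeat (apply/andP; split).
- have -> : n + n.-1 * block_size p B = size (inp ++ out n.-1) by rewrite size_cat si szo.
  by rewrite m' -[LHS]/(upd _ _ _) upd_nth_size -cats1 -catA.
- by rewrite addn1 -addnS addKn.
Qed.

Lemma sreg_eq i j : (sreg i == sreg j) = (i == j).
Proof. by []. Qed.

Lemma low_sreg i j : i < 16 -> (i == sreg j) = false.
Proof. by move=> i16; apply/negbTE; rewrite neq_ltn (leq_trans i16). Qed.

Local Arguments query_digits : simpl never.

(** [U] bounds all intermediate values of [u], since [u %/ B + 1 <= u %/ 2 + 1 <= U] once [2 <= U];
    a single word-size condition therefore covers the whole recursion. *)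
Lemma wp_query B m c u q j z U k (Q : config -> Prop) :
  1 < B -> u <= U -> 2 <= U -> j * B + B + U + 2 < 2 ^ w -> q < 2 ^ w -> z < 2 ^ w ->
  j < 2 ^ w ->
  regs k rK = j -> regs k rB = B -> regs k r1 = 1 -> regs k rU = u -> regs k rP = q ->
  regs k rCnt = z ->
  (forall k',
     (forall i, i < m.+1 -> regs k' (sreg (c + i)) = nth 0 (query_digits B m u q j) i) ->
     regs k' (sreg (c + m.+1)) = z - sumn (query_digits B m u q j) ->
     (forall i, i < 16 -> i \notin [:: rP; rPtr; rU; rCnt; rY] -> regs k' i = regs k i) ->
     (forall i, i < c -> regs k' (sreg i) = regs k (sreg i)) ->
     (forall i, c + m.+1 < i -> regs k' (sreg i) = regs k (sreg i)) ->
     memory k' = memory k -> tape k' = tape k -> Q k') ->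
  wp (query_code m c) Q k.
Proof.
move=> B1; elim: m c u q z k => [|m IH] c u q z k uU U2 hw hq hz hj kK kB k1 kU kP kC HQ.
  rewrite /= /setr /setm /upd /= kK k1 kB kU kC !(eqxx (sreg c)).
  have jB : j.-1 * B <= j * B by rewrite leq_mul2r leq_pred orbT.
  rewrite subn1; split; first by lia.
  split; first by lia.
  split; first by lia.
  split; first exact: leq_ltn_trans (leq_subr _ _) hz.
  split; first exact: leq_ltn_trans (leq_subr _ _) hz.
  apply: HQ => //=.
  + by case=> // _; rewrite addn0 !sreg_eq eqxx ltn_eqF.
  + by rewrite addn1 eqxx addn0.
  + move=> i i16; rewrite !inE !negb_or => /and5P[? ? ? ? ?].
    by rewrite !low_sreg // !ifN.
  + by move=> i ic; rewrite !sreg_eq !ltn_eqF // ltnW.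
  + by move=> i; rewrite addn1 => ic; rewrite !sreg_eq !gtn_eqF // ltnW.
have b2 : q %% 2 < 2 by rewrite ltn_pmod.
have jb : (j - q %% 2) * B <= j * B by rewrite leq_mul2r leq_subr orbT.
have uB : u %% B < B by rewrite ltn_pmod // ltnW.
have u2 : u %/ B <= u %/ 2 by apply: leq_div2l.
have q2 := leq_div q 2.
have uU' : u %/ B + q %% 2 <= U by lia.
rewrite [query_code _ _]/=.
do 10!(exec ltac:(rewrite ?configE /= ?(eqxx (sreg c)) ?kK ?kB ?kU ?kP ?kC; reflexivity);
  first by [lia|apply: leq_ltn_trans (leq_subr _ _) _]).
apply: (IH c.+1 (u %/ B + q %% 2) (q %/ 2) (z - ((j - q %% 2) * B + u %% B))) => //=; try lia.
  exact: leq_ltn_trans (leq_subr _ _) _.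
move=> k' dk fk lk ck hk mk tk; apply: HQ => //=.
- case=> [|i] im; last by rewrite -addSnnS dk.
  by rewrite addn0 ck // /upd eqxx.
- by rewrite -addSnnS fk -subnDA.
- move=> i i16 hi; rewrite lk //; move: hi; rewrite !inE !negb_or => /and5P[? ? ? ? ?].
  by rewrite /upd !low_sreg // !ifN.
- move=> i ic; rewrite ck; last exact: ltnW.
  by rewrite /upd !sreg_eq !(ltn_eqF ic).
- move=> i; rewrite -addSnnS => ic; rewrite hk // /upd !sreg_eq.
  by rewrite (_ : (i == c) = false) //; lia.
Qed.

End Program.

Lemma size_query_code p c : size (query_code p c) = 10 * p + 5.
Proof.
elim: p c => // p IH c.
by rewrite -[LHS]/((size (query_code p c.+1)).+4.+4.+2) IH; lia.
Qed.

Local Opaque query_code.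

Definition simulates (n : nat) (k K : config) : Prop :=
  [/\ forall i, regs K (sreg i) = regs k i,
      forall a, memory K (n + a) = memory k a & tape K = tape k].

Section Program.
Variables (w : nat) (xi : nat -> bool).
Local Notation ends_within := (ends_within w xi).
Local Notation wp := (wp w).

Lemma ends_within_Sim ws pr n k K t k' (Q : config -> Prop) :
  2 ^ ws + n <= 2 ^ w -> simulates n k K -> regs K 0 = n -> pc k = 0 ->
  halts ws pr xi k t k' ->
  (forall K', simulates n k' K' -> (forall i, i < 16 -> i != 1 -> regs K' i = regs K i) ->
     (forall a, a < n -> memory K' a = memory K a) -> Q K') ->
  ends_within (Sim pr) (2 * t) Q K.
Proof.
move=> hw [sr sm st] Kn pk hk HQ.
have hwK : 2 ^ ws + regs K 0 <= 2 ^ w by rewrite Kn.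
have rK : sim_rel K k K by rewrite /sim_rel Kn.
have [K' [rK' [sr' l' m' sm' st']]] := runs_Sim hwK rK pk hk.
rewrite Kn in m' sm'.
by exists t.*2, K'; rewrite mul2n; split=> //; exact: HQ.
Qed.

(** * The loop over all queries *)

Section Queries.
Variables (ws : nat) (qprog : program) (p B n : nat) (y : nat -> nat).
Variables (ks : nat -> config) (ts : nat -> nat) (occ : nat -> Prop).

(** This is [x_k + B ^ p.+1]. The offset [n ^ 2] of the stored values cancels in a difference of two
    of them but not in [x_k] alone, so it is removed here. *)
Definition query_shift (k : nat) : nat := y k.-1 + (B ^ p.+1 - n ^ 2).

(** The counter starts at [2 ^ p], so that the distance [q %/ 2 ^ p] runs from 1 to [n.-1], each
    value being kept for [2 ^ p] guesses. *)
Definition nth_query (j : nat) : p.+3.-tuple nat :=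
  let q := 2 ^ p + j in query_tuple p B (query_shift (q %/ 2 ^ p)) q (q %/ 2 ^ p).

Lemma regs_load_query j k i : regs (load_query (nth_query j) k) i =
  if i < p.+3 then
    nth 0 (query p B (query_shift ((2 ^ p + j) %/ 2 ^ p)) (2 ^ p + j) ((2 ^ p + j) %/ 2 ^ p)) i
  else regs k i.
Proof.
rewrite -[LHS]/(if i < p.+3 then nth 0 (nth_query j) i else regs k i).
case: ifP => // ip.
by rewrite -[i]/(val (Ordinal ip)) -tnth_nth tnth_mktuple.
Qed.

Hypotheses (B_gt1 : 1 < B) (P_gt : 2 * n ^ 2 < B ^ p.+1).
Hypotheses (y_le : forall i, y i <= 2 * n ^ 2).
Hypotheses (w_ws : 2 ^ ws + n <= 2 ^ w).
Hypothesis w_text : n.-1 * block_size p B + block_size p B + 2 * B ^ p.+1 + 4 < 2 ^ w.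
Hypothesis w_queries : n * 2 ^ p + 2 ^ p + 1 < 2 ^ w.

Hypothesis query_halts : forall j, j < n.-1 * 2 ^ p ->
  halts ws qprog xi (load_query (nth_query j) (ks j)) (ts j) (ks j.+1).
Hypothesis query_decides : forall j, j < n.-1 * 2 ^ p -> decides (ks j.+1) (occ j).

Let answer (j : nat) : bool := has (fun i => `[< occ i >]) (iota 0 j).

Let inv (j : nat) (K : config) : Prop :=
  [/\ simulates n (ks j) K, forall a, a < n -> memory K a = y a,
      [/\ regs K 0 = n, regs K 2 = B, regs K 4 = block_size p B & regs K 5 = 1],
      [/\ regs K 11 = B ^ p.+1 - n ^ 2, regs K 9 = 2 ^ p & regs K 13 = 2 ^ p + j]
    & regs K 6 = n.-1 * 2 ^ p - j /\ regs K 15 = answer j].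

Lemma ends_within_query_step j K : j < n.-1 * 2 ^ p -> inv j K ->
  ends_within (query_step p qprog) (10 * p + 16 + 2 * ts j) (inv j.+1) K.
Proof.
move=> jN [[sr sm st] mK [K0 K2 K4 K5] [K11 K9 K13] [K6 K15]].
set k := (2 ^ p + j) %/ 2 ^ p.
have H0 : 0 < 2 ^ p by rewrite expn_gt0.
have k_gt0 : 0 < k by rewrite divn_gt0 // leq_addr.
have k_lt : k <= n.-1 by rewrite -ltnS ltn_divLR // mulSn ltn_add2l.
have k1n : k.-1 < n by lia.
have kL : k * block_size p B <= n.-1 * block_size p B by rewrite leq_mul2r k_lt orbT.
have LE : block_size p B = (3 * p.+1 * B).+1 by [].
have LB : B <= block_size p B by rewrite LE ltnW // ltnS leq_pmull.
have kB : k * B <= k * block_size p B by rewrite leq_mul2l LB orbT.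
have kkL : k <= k * block_size p B by rewrite leq_pmulr // LE.
have n2 : n * n < B ^ p.+1 by rewrite mulnn; lia.
have yk := y_le k.-1.
have nH : n.-1 * 2 ^ p <= n * 2 ^ p by rewrite leq_mul2r leq_pred orbT.
have k_q : k <= 2 ^ p + j by apply: leq_div.
set u := query_shift k.
have u_le : u <= 2 * B ^ p.+1 by rewrite /u /query_shift; lia.
apply: (@ends_within_Seq _ _ _ _ (10 * p + 13) (2 * ts j + 3)); first by lia.
apply: ends_within_Basic; first by rewrite /= size_query_code; lia.
rewrite !cat_cons cat0s.
do 2!(exec ltac:(rewrite ?configE /= ?K9 ?K13 ?K5; reflexivity); rewrite -/k ?subn1;
  first by lia).
exec ltac:(rewrite ?configE /= ?(mK _ k1n); reflexivity); [by lia|by lia|].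
do 5!(exec ltac:(rewrite ?configE /= ?K13 ?K11 ?K4 ?K5; reflexivity);
  first by rewrite -/u; lia).
rewrite -[y _ + _]/u.
apply: (@wp_query _ B p 0 u (2 ^ p + j) k (k * block_size p B - k) (2 * B ^ p.+1)) => //=.
all: try lia.
move=> K1 d1 f1 l1 _ h1 m1 t1.
(* The query has been computed directly into the simulated registers 0 to [p.+2]; those above still
   hold what the data structure left there, as [load_query] requires. *)
have sim1 : simulates n (load_query (nth_query j) (ks j)) K1.
  split; rewrite ?t1 ?m1 // => i; rewrite regs_load_query -/k -/u.
  have [ip|ip|->] := ltngtP i p.+1.
  - by rewrite (ltn_trans ip) ?nth_query_digits ?leqnSn -?d1.
  - rewrite ltnS h1 //; have [->|ip2] := eqVneq i p.+2.
      by rewrite ltnSn nth_query_sep /upd sreg_eq eqxx addn1.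
    rewrite (_ : (i <= p.+2) = false); last by lia.
    by rewrite /upd sreg_eq (negbTE ip2) sr.
  - by rewrite ltnS leqnSn nth_query_filler -f1.
apply: (@ends_within_Seq _ _ _ _ (2 * ts j) 3); first by lia.
apply: (ends_within_Sim w_ws sim1 _ _ (query_halts jN)) => //; first by rewrite l1.
move=> K2' [sr2 sm2 st2] l2 m2.
have low i : i < 16 -> i \notin [:: 1; 3; 7; 8; 10; 12; 14] -> regs K2' i = regs K i.
  move=> i16; rewrite !inE !negb_or => /and5P[? ? ? ? /and3P[? ? ?]].
  rewrite l2 // l1 //; last by rewrite !inE !negb_or; repeat (apply/andP; split).
  by rewrite /upd low_sreg // !ifN.
have ans : regs K2' (sreg 0) = `[< occ j >].
  by rewrite sr2; have [[-> o]|[-> o]] := query_decides jN; [rewrite asboolT|rewrite asboolF].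
apply: ends_within_Basic => //.
have lor_bool (b b' : bool) : Nat.lor b b' = b || b' by case: b; case: b'.
exec ltac:(rewrite ?configE /= ?ans ?(low 15) ?K15 //; reflexivity); rewrite lor_bool.
  by apply: leq_ltn_trans (leq_b1 _) _; lia.
exec ltac:(rewrite ?configE /= ?(low 13) ?(low 5) ?K13 ?K5 //; reflexivity).
  by lia.
exec ltac:(rewrite ?configE /= ?(low 6) ?(low 5) ?K6 ?K5 //; reflexivity).
  by lia.
split; rewrite ?configE /=.
- by split.
- by move=> a an; rewrite m2 // m1 mK.
- by rewrite !low.
- by rewrite addn1 addnS !low.
- by rewrite subn1 subnS /answer -[j.+1]addn1 iotaD has_cat /= orbF.
Qed.

Lemma ends_within_queries K (Q : config -> Prop) :
  simulates n (ks 0) K -> (forall a, a < n -> memory K a = y a) ->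
  regs K 0 = n -> regs K 2 = B -> regs K 3 = B ^ p.+1 -> regs K 4 = block_size p B ->
  regs K 5 = 1 ->
  (forall K', decides K' (exists2 j, j < n.-1 * 2 ^ p & occ j) -> Q K') ->
  ends_within (queries_code p qprog)
    (9 + \sum_(j < n.-1 * 2 ^ p) (10 * p + 18 + 2 * ts j)) Q K.
Proof.
move=> [sr sm st] mK K0 K2 K3 K4 K5 HQ.
have nP : n * n < B ^ p.+1 by rewrite mulnn; lia.
have nH : n.-1 * 2 ^ p <= n * 2 ^ p by rewrite leq_mul2r leq_pred orbT.
apply: (@ends_within_Seq _ _ _ _ 7
   ((\sum_(j < n.-1 * 2 ^ p) (10 * p + 16 + 2 * ts j).+2).+1 + 1)).
  rewrite addn1 -[leqLHS]/(9 + _) leq_add2l; apply: leq_sum => j _; lia.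
apply: ends_within_Basic => //.
exec ltac:(rewrite ?configE /= K0; reflexivity); first by lia.
exec ltac:(rewrite ?configE /= ?K3; reflexivity); first by lia.
exec idtac; first by lia.
exec ltac:(rewrite ?configE /=; reflexivity); first by lia.
exec ltac:(rewrite ?configE /= ?K0 ?K5; reflexivity); first by lia.
exec ltac:(rewrite ?configE /=; reflexivity); first by rewrite subn1; lia.
exec idtac; first by rewrite expn_gt0.
apply: (@ends_within_Seq _ _ _ _ _ 1 _ _ _ (leqnn _)).
apply: (@ends_within_mono _ _ _ _ _ (inv (n.-1 * 2 ^ p))); first exact: leqnn; last first.
  apply: (@ends_within_While _ _ _ _ _ (fun j => 10 * p + 16 + 2 * ts j)).
  - by move=> j K' jN [_ _ _ _ [-> _]]; rewrite -lt0n subn_gt0.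
  - by move=> K' [_ _ _ _ [-> _]]; rewrite subnn.
  - by move=> j K' jN; apply: ends_within_query_step.
  - split; rewrite ?configE //=.
      by rewrite mulnn addn0.
    by rewrite subn0 subn1.
move=> K' [_ _ _ _ [_ K15]].
apply: ends_within_Basic => //.
exec ltac:(exact: K15).
  by apply: leq_ltn_trans (leq_b1 _) _; lia.
apply: HQ; rewrite /decides configE /=.
case: (boolP (answer _)) => /hasP ans; [left|right]; split=> //.
  have [j jN /asboolP oj] := ans; exists j => //.
  by move: jN; rewrite mem_iota.
by move=> [j jN oj]; apply: ans; exists j; [rewrite mem_iota|exact/asboolP].
Qed.

End Queries.
(** For fixed coins [xi], the configurations [ks] and times [t0], [ts] record one session of the
    data structure. The reduction flips no coins of its own, so the tape positions agree and the
    simulated programs consume the same [xi]. The factor 2 in the time is the cost of simulation. *)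
Lemma ends_within_reduction ws (pre qprog : program) p B n (x : seq nat)
    (T : seq nat) (ks : nat -> config) (t0 : nat) (ts : nat -> nat) (occ : nat -> Prop) :
  1 < B -> 2 * n ^ 2 < B ^ p.+1 -> (forall b, 1 < b < B -> b ^ p.+1 <= 2 * n ^ 2) ->
  size x = n -> (forall a, a \in x -> a <= 2 * n ^ 2) -> T = text p B n (nth 0 x) ->
  2 ^ ws + n <= 2 ^ w ->
  (n + 1) * block_size p B + 2 * B ^ p.+1 + (n + 1) * 2 ^ p + p + n + 4 < 2 ^ w ->
  halts ws pre xi (start (size T) T) t0 (ks 0) ->
  (forall j, j < n.-1 * 2 ^ p ->
     halts ws qprog xi (load_query (nth_query p B n (nth 0 x) j) (ks j)) (ts j) (ks j.+1)) ->
  (forall j, j < n.-1 * 2 ^ p -> decides (ks j.+1) (occ j)) ->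
  ends_within (reduction p pre qprog)
    (p + 29 + B * (p + 6) + n * (9 * p + 22 + 5 * block_size p B) + 2 * t0 +
     \sum_(j < n.-1 * 2 ^ p) (10 * p + 18 + 2 * ts j))
    (fun K => decides K (exists2 j, j < n.-1 * 2 ^ p & occ j)) (start n x).
Proof.
move=> B1 P_gt B_min sx x_le eT hws hw hpre hq hdec.
set y := nth 0 x.
have y_le i : y i <= 2 * n ^ 2.
  rewrite /y; have [ix|xi'] := ltnP i (size x); first exact/x_le/mem_nth.
  by rewrite nth_default.
have nL : n.-1 * block_size p B <= n * block_size p B by rewrite leq_mul2r leq_pred orbT.
rewrite !mulnDl !mul1n in hw.
have BP : B <= B ^ p.+1 by rewrite expnS leq_pmulr // expn_gt0 ltnW.
set S := \sum_(j < _) _.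
apply: (@ends_within_Seq _ _ _ _ (p.+1 + 8 + B * (p.+1 + 5))
  (11 + n * (9 * p + 22 + 5 * block_size p B) + (2 * t0 + (9 + S)))); first by lia.
apply: (@ends_within_base w xi p.+1 B n) => //; try lia.
move=> k1 [f1 ft1] m1 k1B k1P k11.
apply: (@ends_within_Seq _ _ _ _ _ _ _ _ _ (leqnn _)).
apply: (@ends_within_text w xi B p n x) => //; rewrite ?m1 ?f1 //; try lia.
  by move=> i; have := y_le i; rewrite /y; lia.
move=> k2 [f2 ft2] m2 k2L k2s.
have sim2 : simulates n (start (size T) T) k2.
  split; rewrite ?ft2 ?ft1 //.
    case=> [|i]; first by rewrite k2s eT size_text.
    by rewrite f2 // f1.
  by move=> a; rewrite m2 nth_cat sx ltnNge leq_addr addKn eT.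
apply: (@ends_within_Seq _ _ _ _ _ _ _ _ _ (leqnn _)).
have k2n : regs k2 0 = n by rewrite f2 // f1.
apply: (ends_within_Sim hws sim2 k2n _ hpre) => // k3 sim3 low3 mem3.
apply: (@ends_within_queries ws qprog p B n y ks ts occ) => //; try by [lia|rewrite low3 // f2 // f1].
by move=> a an; rewrite mem3 // m2 nth_cat sx an.
Qed.

End Program.

(** * Running times as random variables *)

Local Open Scope classical_set_scope.

(* A machine that has made t steps has consumed at most t coins, so that
   every event about a halting time is a countable union of events about
   finitely many coins. *)
Definition agree (N : nat) (xi xi' : nat -> bool) : Prop :=
  forall i, i < N -> xi i = xi' i.

Lemma agreeW N N' xi xi' : N' <= N -> agree N xi xi' -> agree N' xi xi'.
Proof. by move=> NN a i iN; apply: a; apply: leq_trans NN. Qed.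

Lemma step_agree w p xi xi' k k' : agree (tape k).+1 xi xi' ->
  step w p xi k = Some k' -> step w p xi' k = Some k' /\ tape k' <= (tape k).+1.
Proof.
move=> a; rewrite /step; case: (onth _ _) => [[d v|d b|o d b c|d b|b c|d|l|b l]|] //=.
all: rewrite /set_reg /Defs.set_mem /=.
all: try by repeat case: ifP => // _; move=> [<-] /=.
by rewrite a //; case: ifP => // _ [<-].
Qed.

Lemma halts_agree w p xi xi' k t k' : agree (tape k + t) xi xi' ->
  halts w p xi k t k' -> halts w p xi' k t k' /\ tape k' <= tape k + t.
Proof.
move=> a [it hp]; suff [it' tk] : iter t (obind (step w p xi')) (Some k) = Some k' /\
    tape k' <= tape k + t by [].
elim: t k' it {hp} a => [|t IH] k' /=.
  by case=> <- _; rewrite addn0.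
case E: (iter t _ _) => [k1|//] /= s1 a.
have at1 : agree (tape k + t) xi xi' by apply: agreeW a; rewrite addnS.
have [-> /= tk1] := IH _ E at1.
have at2 : agree (tape k1).+1 xi xi' by apply: agreeW a; rewrite addnS ltnS.
have [-> tk'] := step_agree at2 s1.
by split=> //; rewrite addnS; apply: leq_trans tk' _.
Qed.

Section Coins.
Variables (R : realType) (d : measure_display) (Om : measurableType d).
Variables (P : probability Om R) (coin : nat -> Om -> bool).
Hypothesis coinP : fair_coins P coin.

(** Induction on [N]: split according to the value of the last coin and substitute it in [E]; both
    halves depend on one coin less. With no coin left the event is empty or everything. *)
Lemma measurable_finitary (E : (nat -> bool) -> Prop) N :
  (forall xi xi', agree N xi xi' -> E xi -> E xi') ->
  measurable [set om | E (coin^~ om)].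
Proof.
elim: N E => [|N IH] E HE.
  have [h|h] := pselect (E (fun=> false)).
    rewrite (_ : [set _ | _] = setT) //; apply/seteqP; split=> // om _.
    by apply: HE h.
  rewrite (_ : [set _ | _] = set0) //; apply/seteqP; split=> // om; apply: contra_not h.
  exact: HE.
pose F b (xi : nat -> bool) := E (fun i => if i == N then b else xi i).
have mF b : measurable [set om | F b (coin^~ om)].
  apply: IH => xi xi' a; apply: HE => i; rewrite ltnS leq_eqVlt.
  by case: eqP => //= _ /a.
have e xi : E xi <-> F (xi N) xi.
  by split; apply: HE => i _; case: eqP => // ->.
rewrite (_ : [set _ | _] = ([set om | coin N om] `&` [set om | F true (coin^~ om)]) `|`
  (~` [set om | coin N om] `&` [set om | F false (coin^~ om)])); last first.
  apply/seteqP; split=> om /=.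
    by move/e => /=; case: (coin N om) => ?; [left|right].
  by case=> -[cN ?]; apply/e; rewrite /= ?cN //; move/negP/negbTE: cN => ->.
have mN := coinP.1 N.
by apply: measurableU; apply: measurableI => //; exact: measurableC.
Qed.

Lemma running_time_lt (D : set nat) (y : \bar R) :
  (running_time R D < y)%E <-> exists2 t, D t & ((t%:R)%:E < y)%E.
Proof.
split=> [/ereal_inf_lt[_ [t Dt <-] lt]|[t Dt lt]]; first by exists t.
by apply: le_lt_trans lt; apply: ereal_inf_lbound; exists t.
Qed.

Lemma running_time_le (D : set nat) t : D t -> (running_time R D <= (t%:R)%:E)%E.
Proof. by move=> Dt; apply: ereal_inf_lbound; exists t. Qed.

Lemma running_time_ge0 (D : set nat) : (0 <= running_time R D)%E.
Proof. by apply: le_ereal_inf_tmp => _ [t _ <-]; rewrite lee_fin ler0n. Qed.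

Lemma running_time_uniq (D : set nat) t :
  D t -> (forall t', D t' -> t' = t) -> running_time R D = (t%:R)%:E.
Proof.
move=> Dt u; apply/eqP; rewrite eq_le running_time_le //=.
by apply: le_ereal_inf_tmp => _ [t' /u -> <-].
Qed.

(** Closed rays generate the measurable sets of extended reals, and the event that the time is below
    [y] is a countable union over the possible values [t]. *)
Lemma measurable_running_time (D : Om -> set nat) :
  (forall t, measurable [set om | D om t]) ->
  measurable_fun setT (fun om => running_time R (D om) : \bar R).
Proof.
move=> mD mT; apply: (measurability _ (ErealGenCInfty.measurableE R)) => //.
move=> _ [_ [y ->] <-]; apply: measurableI => //.
rewrite (_ : _ @^-1` _ = ~` \bigcup_t
    (if ((t%:R : R)%:E < y%:E)%E then [set om | D om t] else set0)).
  by apply: measurableC; apply: bigcupT_measurable => t; case: ifP.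
apply/seteqP; split=> om /=; rewrite ?in_itv /= ?andbT.
  move=> yr [t _]; case: ifP => // ty Dt; move: yr; rewrite leNgt => /negP; apply.
  by apply/running_time_lt; exists t.
move=> h; rewrite leNgt; apply/negP => /running_time_lt[t Dt ty]; apply: h.
by exists t => //; rewrite ty.
Qed.

Lemma measurable_halts w p k : measurable_fun setT
  (fun om => running_time R [set t | exists k', halts w p (coin^~ om) k t k'] : \bar R).
Proof.
apply: measurable_running_time => t.
apply: (@measurable_finitary (fun xi => exists k', halts w p xi k t k') (tape k + t)).
by move=> xi xi' a [k' /(halts_agree a)[h _]]; exists k'.
Qed.

Section Sessions.
Variables (r : nat) (A : jumbled_alg) (s : nat) (S : s.-tuple 'I_r).
Let word := word_bits (jumbled_word A) s.

(** No fixed number of coins determines a session. With at most [T] steps per phase,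
    [(size psis).+1 * T] coins suffice, and sessions are the union over all [T]. *)
Fixpoint bounded_session (T : nat) (xi : nat -> bool) (psis : seq (r.-tuple nat))
    (k : config) : Prop :=
  match psis with
  | [::] => exists2 t, t <= T &
      halts word (pre_prog A) xi (start s [seq val a | a <- S]) t k
  | psi :: psis' => exists k0 t, [/\ t <= T, bounded_session T xi psis' k0 &
      halts word (query_prog A) xi (load_query psi k0) t k]
  end.

Lemma bounded_sessionW T T' xi psis k : T <= T' ->
  bounded_session T xi psis k -> bounded_session T' xi psis k.
Proof.
move=> TT'; elim: psis k => [|psi psis IH] k /=.
  by move=> [t tT h]; exists t => //; apply: leq_trans TT'.
move=> [k0 [t [tT /IH h1 h2]]]; exists k0, t; split=> //.
exact: leq_trans TT'.
Qed.

Lemma sessionP om psis k :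
  session coin A S om psis k <-> exists T, bounded_session T (coin^~ om) psis k.
Proof.
elim: psis k => [|psi psis IH] k /=.
  by split=> [[t h]|[T [t _ h]]]; [exists t, t|exists t].
split=> [[k0 [t [/IH[T h1] h2]]]|[T [k0 [t [_ h1 h2]]]]].
  exists (maxn t T), k0, t; split=> //; first exact: leq_maxl.
  by apply: bounded_sessionW h1; exact: leq_maxr.
by exists k0, t; split=> //; apply/IH; exists T.
Qed.

Lemma bounded_session_agree T xi xi' psis k : agree ((size psis).+1 * T) xi xi' ->
  bounded_session T xi psis k ->
  bounded_session T xi' psis k /\ tape k <= (size psis).+1 * T.
Proof.
elim: psis k => [|psi psis IH] k /= a.
  move=> [t tT h]; have at1 : agree (0 + t) xi xi' by apply: agreeW a; rewrite mul1n.
  have [h' tk] := halts_agree (k := start s [seq val a | a <- S]) at1 h; split; first by exists t.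
  by rewrite mul1n (leq_trans tk).
move=> [k0 [t [tT h1 h2]]]; rewrite mulSn in a *.
have [|h1' tk1] := IH _ _ h1; first by apply: agreeW a; rewrite leq_addl.
have at1 : agree (tape k0 + t) xi xi' by apply: agreeW a; rewrite addnC leq_add.
have [h' tk] := halts_agree (k := load_query psi k0) at1 h2; split; first by exists k0, t.
by apply: leq_trans tk _; rewrite addnC leq_add.
Qed.

Lemma measurable_query_time psis (psi : r.-tuple nat) : measurable_fun setT
  (fun om => running_time R [set t | exists k k', session coin A S om psis k /\
                                 query_halts coin A s om psi k t k'] : \bar R).
Proof.
apply: measurable_running_time => t.
pose E T xi := exists k k', bounded_session T xi psis k /\
  halts word (query_prog A) xi (load_query psi k) t k'.
rewrite (_ : [set _ | _] = \bigcup_T [set om | E T (coin^~ om)]).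
  apply: bigcupT_measurable => T; apply: (@measurable_finitary _ ((size psis).+1 * T + t)).
  move=> xi xi' a [k [k' [h1 h2]]].
  have a1 : agree ((size psis).+1 * T) xi xi' by apply: agreeW a; exact: leq_addr.
  have [h1' tk] := bounded_session_agree a1 h1.
  have a2 : agree (tape (load_query psi k) + t) xi xi' by apply: agreeW a; rewrite leq_add2r.
  have [h2' _] := halts_agree a2 h2.
  by exists k, k'.
apply/seteqP; split=> om /=.
  by move=> [k [k' [/sessionP[T h1] h2]]]; exists T => //; exists k, k'.
by move=> [T _ [k [k' [h1 h2]]]]; exists k, k'; split=> //; apply/sessionP; exists T.
Qed.

Lemma session_uniq om psis k1 k2 :
  session coin A S om psis k1 -> session coin A S om psis k2 -> k1 = k2.
Proof.
elim: psis k1 k2 => [|psi psis IH] k1 k2 /=.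
  by move=> [t h1] [t' h2]; have [] := halts_uniq h1 h2.
move=> [k [t [h1 h2]]] [k' [t' [h1' h2']]]; rewrite (IH _ _ h1 h1') in h2.
by have [] := halts_uniq h2 h2'.
Qed.

End Sessions.
End Coins.

(** * Size of the base and of the words *)

Lemma least_base p n : exists B, [/\ 1 < B, 2 * n ^ 2 < B ^ p.+1
  & forall b, 1 < b < B -> b ^ p.+1 <= 2 * n ^ 2].
Proof.
have ex : exists B, (1 < B) && (2 * n ^ 2 < B ^ p.+1).
  exists (2 * n ^ 2).+2; rewrite ltnS /= [_ ^ p.+1]expnS.
  by apply: (@leq_trans (2 * n ^ 2).+2); rewrite // leq_pmulr ?expn_gt0.
exists (ex_minn ex); case: ex_minnP => B /andP[B1 PB] least; split=> // b /andP[b1 bB].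
by rewrite leqNgt; apply/negP => h; have := least b; rewrite b1 h leqNgt bB => /(_ isT).
Qed.

(** Minimality applies to [B.-1], and [B <= 2 * B.-1]; the case [B = 2], where there is no smaller
    candidate, is covered by the [+ 1]. *)
Lemma least_base_le p n B : 1 < B -> (forall b, 1 < b < B -> b ^ p.+1 <= 2 * n ^ 2) ->
  B ^ p.+1 <= 2 ^ p.+1 * (2 * n ^ 2 + 1).
Proof.
move=> B1 least; have [B2|B2] := leqP B 2.
  apply: (@leq_trans (2 ^ p.+1)); first by rewrite leq_exp2r.
  by rewrite leq_pmulr // addn1.
apply: (@leq_trans ((2 * B.-1) ^ p.+1)); first by rewrite leq_exp2r //; lia.
rewrite expnMn leq_pmul2l ?expn_gt0 //.
by apply: leq_trans (least B.-1 _) (leq_addr _ _); lia.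
Qed.

Lemma word_size p c : 0 < c -> exists2 c', 0 < c' & forall n B, 1 < B ->
  (forall b, 1 < b < B -> b ^ p.+1 <= 2 * n ^ 2) ->
  2 ^ word_bits c (n.-1 * block_size p B).+1 + n <= 2 ^ word_bits c' n /\
  (n + 1) * block_size p B + 2 * B ^ p.+1 + (n + 1) * 2 ^ p + p + n + 4 < 2 ^ word_bits c' n.
Proof.
move=> c0.
(* [D] adds up the coefficients of [a ^ 3] in the bounds [h1] to [h5] below, where [a = 2 ^ l]
   exceeds [n]. Since [D < a ^ D], this constant is absorbed in the exponent [D + 3]. *)
pose D := 9 * p.+1 * 2 ^ p.+1 + 6 * 2 ^ p.+1 + 2 ^ p + p + 6.
exists (c * (D + 3) + 1); first by rewrite addn1.
move=> n B B1 least; have := least_base_le B1 least.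
rewrite /word_bits; set l := (trunc_log 2 n).+1; set P := B ^ p.+1 => hP.
set U := (n + 1) * _ + _ + _ + _ + _ + _.
have n_lt : n < 2 ^ l by exact: trunc_log_ltn.
have a2 : 2 <= 2 ^ l by rewrite -[X in X <= _]expn1 leq_exp2l.
set a := 2 ^ l in n_lt a2 *.
have D0 : 0 < D by rewrite /D addnC.
have hD : D < a ^ D by apply: leq_trans (ltn_expl D (isT : 1 < 2)) _; rewrite leq_exp2r.
have hU : U <= D * a ^ 3.
  have BP : B <= P by rewrite /P expnS leq_pmulr // expn_gt0 ltnW.
  have a1 : 1 <= a by exact: ltnW.
  have aa : a <= a ^ 2 by rewrite -mulnn leq_pmulr.
  have aaa : a ^ 2 <= a ^ 3 by rewrite leq_exp2l.
  have P3 : P <= 2 ^ p.+1 * (3 * a ^ 2).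
    apply: leq_trans hP _; rewrite leq_pmul2l ?expn_gt0 //.
    have : n ^ 2 <= a ^ 2 by rewrite leq_exp2r // ltnW.
    by lia.
  have bsP : block_size p B <= 3 * p.+1 * (2 ^ p.+1 * (3 * a ^ 2)) + 1.
    by rewrite /block_size addn1 ltnS leq_mul2l (leq_trans BP P3) orbT.
  have n1 : n + 1 <= a by rewrite addn1.
  have h1 : (n + 1) * block_size p B <= (9 * p.+1 * 2 ^ p.+1) * a ^ 3 + a ^ 3.
    apply: leq_trans (leq_mul n1 bsP) _; rewrite mulnDr muln1 leq_add ?(leq_trans aa) //.
    by rewrite [a ^ 3]expnS; apply: eq_leq; lia.
  have h2 : 2 * P <= 6 * 2 ^ p.+1 * a ^ 3.
    apply: (@leq_trans (6 * 2 ^ p.+1 * a ^ 2)); first by lia.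
    by rewrite leq_mul2l aaa orbT.
  have h3 : (n + 1) * 2 ^ p <= 2 ^ p * a ^ 3.
    by rewrite mulnC leq_mul2l (leq_trans n1) ?orbT // (leq_trans aa).
  have h4 : p <= p * a ^ 3 by rewrite leq_pmulr // expn_gt0 a1.
  have h5 : n + 4 <= 5 * a ^ 3.
    have : a <= a ^ 3 by exact: leq_trans aaa.
    by lia.
  have -> : D * a ^ 3 = 9 * p.+1 * 2 ^ p.+1 * a ^ 3 + a ^ 3 + 6 * 2 ^ p.+1 * a ^ 3 +
      2 ^ p * a ^ 3 + p * a ^ 3 + 5 * a ^ 3.
    by rewrite /D; move: (2 ^ p.+1) (2 ^ p) (a ^ 3) => *; ring.
  rewrite /U; move: h1 h2 h3 h4 h5; clear.
  move: (_ * block_size p B) (2 * P) (_ * 2 ^ p) (9 * _ * _ * _) (6 * _ * _) (2 ^ p * _) (p * _).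
  by move: (a ^ 3) => *; lia.
have hUa : U < a ^ (D + 3) by rewrite expnD (leq_ltn_trans hU) // ltn_pmul2r // expn_gt0 ltnW.
have hs : (n.-1 * block_size p B).+1 <= U.
  rewrite /U; have : n.-1 * block_size p B <= (n + 1) * block_size p B.
    by rewrite leq_mul2r; apply/orP; right; lia.
  by lia.
have hl : (trunc_log 2 (n.-1 * block_size p B).+1).+1 <= l * (D + 3).
  rewrite -(@ltn_exp2l 2) // expnM.
  by apply: leq_ltn_trans hUa; apply: leq_trans hs; exact: trunc_logP.
(* [M] bounds the range of the simulated words. The further factor [a], paid for by the [+ 1] in the
   new constant, leaves room for the displacement by [n]. *)
pose M := 2 ^ (c * (l * (D + 3))).
have -> : 2 ^ ((c * (D + 3) + 1) * l) = a * M.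
  by rewrite mulnDl mul1n expnD mulnC -mulnA [_ * l]mulnC.
have M0 : 0 < M by rewrite expn_gt0.
have hM : a ^ (D + 3) <= M.
  by rewrite /a -expnM leq_exp2l // leq_pmull.
split; last by apply: leq_trans hUa (leq_trans hM _); rewrite leq_pmull // ltnW.
apply: (@leq_trans (M + n * M)).
  by rewrite leq_add ?leq_pmulr // leq_exp2l // leq_mul2l hl orbT.
by rewrite -mulSn leq_pmul2r.
Qed.

(** * Convolution-3SUM in terms of jumbled queries *)

Section Conv3sum.
Variables (p B n : nat) (x : n.-tuple int).
Hypotheses (B_gt1 : 1 < B) (P_gt : 2 * n ^ 2 < B ^ p.+1) (x_range : conv3sum_range x).

Definition shifted_input : seq nat := [seq absz (a + (n ^ 2)%:Z)%R | a <- x].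
Let y := nth 0 shifted_input.

Lemma size_shifted_input : size shifted_input = n.
Proof. by rewrite size_map size_tuple. Qed.

Lemma shifted_inputE i : i < n -> ((y i)%:Z = nth 0 x i + (n ^ 2)%:Z)%R.
Proof.
clear B_gt1 P_gt; move=> i_n; rewrite /y (nth_map 0%R) ?size_tuple //.
have /x_range /andP[] : nth 0%R x i \in (x : seq int) by rewrite mem_nth ?size_tuple.
by move: (nth _ _ _) (n ^ 2) => a N h1 h2; lia.
Qed.

Lemma shifted_input_le a : a \in shifted_input -> a <= 2 * n ^ 2.
Proof.
clear B_gt1 P_gt; move=> /mapP[b /x_range /andP[]]; move: (n ^ 2) => N h1 h2 ->; lia.
Qed.

Lemma shifted_input_lt i : y i < B ^ p.+1.
Proof.
apply: leq_ltn_trans P_gt; rewrite /y; have [i_n|n_i] := ltnP i n.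
  by apply/shifted_input_le/mem_nth; rewrite size_shifted_input.
by rewrite nth_default // size_shifted_input.
Qed.

Lemma query_shift_le k : query_shift p B n y k <= 2 * B ^ p.+1 + 2.
Proof. by have := shifted_input_lt k.-1; rewrite /query_shift; lia. Qed.

Lemma conv3sum_occurs :
  (exists2 j, j < n.-1 * 2 ^ p &
     jumbled_occurs (text_tuple p B_gt1 n y) (nth_query p B n y j)) <-> conv3sum x.
Proof.
have H0 : 0 < 2 ^ p by rewrite expn_gt0.
(* Once the offsets are removed, the equation over the naturals is the Convolution-3SUM equation for
   the 1-based indices [i + k + 1] and [i + 1], whose difference is [k]. *)
have key k i : 0 < k -> i + k < n ->
    query_shift p B n y k + y i = B ^ p.+1 + y (i + k) <->
    (nth 0 x (i + k) - nth 0 x i = nth 0 x k.-1)%R.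
  move=> k0 ikn; rewrite /query_shift.
  have /shifted_inputE e1 : k.-1 < n by lia.
  have /shifted_inputE e2 : i < n by lia.
  have /shifted_inputE e3 : i + k < n by lia.
  move: P_gt e1 e2 e3; move: (y _) (y _) (y _) (nth _ _ _) (nth _ _ _) (nth _ _ _).
  by move: (n ^ 2) (B ^ p.+1) => N P a b c a' b' c' *; lia.
split=> [[j jN]|[i [j [j0 ji i_n e]]]].
  have k0 : 0 < (2 ^ p + j) %/ 2 ^ p by rewrite divn_gt0 // leq_addr.
  move=> /(jumbled_occurs_sound k0 (query_shift_le _) shifted_input_lt)[i ikn /key].
  move=> /(_ k0 ikn) e; exists (i + (2 ^ p + j) %/ 2 ^ p).+1, i.+1.
  by split=> //; rewrite ?ltnS ?subSS ?addKn //; lia.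
set k := i - j.
have k0 : 0 < k by rewrite subn_gt0.
have ek : i.-1 = j.-1 + k by rewrite /k; lia.
have ikn : j.-1 + k < n by lia.
have {}e : query_shift p B n y k + y j.-1 = B ^ p.+1 + y (j.-1 + k).
  by apply/key => //; rewrite -ek.
have [q q_lt occ] := jumbled_occurs_complete B_gt1 k0 (query_shift_le k)
  shifted_input_lt ikn e k.
(* [k.-1] and not [k], because [nth_query] adds [2 ^ p] to its argument. *)
exists (k.-1 * 2 ^ p + q).
  apply: (@leq_trans (k.-1 * 2 ^ p + 2 ^ p)); first by rewrite ltn_add2l.
  by rewrite -mulSnr leq_mul2r; apply/orP; right; lia.
rewrite /nth_query addnA -mulSn prednK //.
by rewrite divnMDl // divn_small // addn0.
Qed.

(** An entry is at most the sum of all entries, the length of a window of at most [n.-1] blocks.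
    Hence the queries consist of words of the data structure. *)
Lemma nth_query_le j a : j < n.-1 * 2 ^ p -> a \in nth_query p B n y j ->
  a <= (n.-1 * block_size p B).+1.
Proof.
move=> jN /tnthP[i ->]; rewrite tnth_mktuple.
have H0 : 0 < 2 ^ p by rewrite expn_gt0.
set k := _ %/ _; have k0 : 0 < k by rewrite divn_gt0 // leq_addr.
have k_lt : k <= n.-1 by rewrite -ltnS ltn_divLR // mulSn ltn_add2l.
apply: (@leq_trans (k * block_size p B).+1); last by rewrite ltnS leq_mul2r k_lt orbT.
rewrite -(sumn_query B_gt1 (2 ^ p + j) k0 (query_shift_le k)).
set s := query _ _ _ _ _.
have : i < size s by rewrite size_query.
elim: s (val i) => // b s IH [|i'] /= i_lt; first exact: leq_addr.
by apply: leq_trans (IH _ i_lt) (leq_addl _ _).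
Qed.

End Conv3sum.

(** * Expected time of the reduction *)

Lemma ends_within_halts w xi c t Q k : pc k = 0 -> ends_within w xi c t Q k ->
  exists t' k', [/\ t' <= t, halts w (compile c 0) xi k t' (goto k' (csize c)) & Q k'].
Proof.
move=> pk [t' [k' [tt' r Qk']]]; exists t', k'; split=> //; split; last first.
  by rewrite size_compile.
have := r [::] [::]; rewrite /= cats0 add0n => <-.
by congr (iter _ _ (Some _)); case: k pk {r} => ? ? ? ? /= ->.
Qed.

Section Expectation.
Variables (R : realType) (d : measure_display) (Om : measurableType d).
Variables (P : probability Om R) (coin : nat -> Om -> bool).
Hypothesis coinP : fair_coins P coin.
Variables (p : nat) (A : jumbled_alg).
Hypothesis A_solves : solves_jumbled P coin p.+3 A.
Variable c : nat.

Definition reduction_alg : conv3sum_alg :=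
  Conv3sumAlg (compile (reduction p (pre_prog A) (query_prog A)) 0) c.

Section Input.
Variables (n B : nat) (x : n.-tuple int).
Hypotheses (B_gt1 : 1 < B) (P_gt : 2 * n ^ 2 < B ^ p.+1).
Hypothesis B_least : forall b, 1 < b < B -> b ^ p.+1 <= 2 * n ^ 2.
Hypothesis x_range : conv3sum_range x.
Hypothesis word_ge :
  2 ^ word_bits (jumbled_word A) (n.-1 * block_size p B).+1 + n <= 2 ^ word_bits c n.
Hypothesis word_gt : (n + 1) * block_size p B + 2 * B ^ p.+1 + (n + 1) * 2 ^ p + p + n + 4 <
  2 ^ word_bits c n.

Let y := nth 0 (shifted_input x).
Let s := (n.-1 * block_size p B).+1.
Let S : s.-tuple 'I_p.+3 := text_tuple p B_gt1 n y.
Let N := n.-1 * 2 ^ p.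
Let psi : nat -> p.+3.-tuple nat := nth_query p B n y.

(** Latest query first, as [session] expects. The list depends on the input alone and not on the
    coins, so the expected time of query [j] is one of the numbers whose supremum is
    [query_time]. *)
Fixpoint history (j : nat) : seq (p.+3.-tuple nat) :=
  if j is j'.+1 then psi j' :: history j' else [::].

Lemma word_queries_history j : j < N -> word_queries A s (psi j :: history j).
Proof.
have word_psi i : i < N -> word_query A s (psi i).
  move=> iN a /(nth_query_le B_gt1 P_gt x_range iN) a_le; apply: leq_ltn_trans a_le _.
  apply: leq_trans (trunc_log_ltn s (isT : 1 < 2)) _.
  by rewrite leq_exp2l // /word_bits leq_pmull //; case: A_solves.
move=> jN phi; rewrite inE => /predU1P[->|]; first exact: word_psi.
elim: j jN => // j IH jN; rewrite inE => /predU1P[->|].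
  by apply: word_psi; exact: ltnW.
by apply: IH; exact: ltnW.
Qed.

Let pre_time (om : Om) : \bar R := running_time R [set t | exists k, pre_halts coin A S om t k].

Let query_time_at (j : nat) (om : Om) : \bar R :=
  running_time R [set t | exists k k', session coin A S om (history j) k /\
                                 query_halts coin A s om (psi j) k t k'].

Let overhead : nat :=
  p + 29 + B * (p + 6) + n * (9 * p + 22 + 5 * block_size p B).

(** Outside a countable union of null sets every phase halts with a correct answer. The sessions
    obtained separately for each query are glued to one sequence [ks] by the uniqueness of halting
    configurations, and the simulation then yields a run of the reduction. *)
Lemma ae_runs : {ae P, forall om, exists t k (t0 : nat) (ts : nat -> nat),
  [/\ conv3sum_halts coin reduction_alg x om t k, decides k (conv3sum x),
      pre_time om = (t0%:R)%:E, forall j, j < N -> query_time_at j om = ((ts j)%:R)%:E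
    & t <= overhead + 2 * t0 + \sum_(j < N) (10 * p + 18 + 2 * ts j)]}.
Proof.
have [pre_ok query_ok] := A_solves.2 s S.
have all_ok : {ae P, forall om, forall j, j < N -> exists k t k',
    [/\ session coin A S om (history j) k, query_halts coin A s om (psi j) k t k'
      & decides k' (jumbled_occurs S (psi j))]}.
  apply: ae_foralln => j; have [jN|jN] := ltnP j N; last by apply: aeW.
  by apply: filterS (query_ok _ _ (word_queries_history jN)) => om.
move: pre_ok all_ok; apply: filterS2 => om [t0 [k0 pre0]] steps.
have [ks ksP] : exists ks : nat -> config, forall j, j <= N -> session coin A S om (history j) (ks j).
  have ex j : exists k, j <= N -> session coin A S om (history j) k.
    have [jN|jN] := leqP j N; last by exists k0.
    case: j jN => [|j] jN; first by exists k0 => _; exists t0.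
    have [k [t [k' [h1 h2 _]]]] := steps j jN.
    by exists k' => _; exists k, t.
  by have [ks ksP] := choice ex; exists ks.
have [ts tsP] : exists ts : nat -> nat, forall j, j < N ->
    query_halts coin A s om (psi j) (ks j) (ts j) (ks j.+1) /\
    decides (ks j.+1) (jumbled_occurs S (psi j)).
  have ex j : exists t, j < N -> query_halts coin A s om (psi j) (ks j) t (ks j.+1) /\
      decides (ks j.+1) (jumbled_occurs S (psi j)).
    have [jN|jN] := ltnP j N; last by exists 0.
    have [k [t [k' [h1 h2 dk']]]] := steps j jN; exists t => _.
    rewrite -(session_uniq h1 (ksP j (ltnW jN))).
    have hk' : session coin A S om (history j.+1) k' by exists k, t.
    by rewrite -(session_uniq hk' (ksP j.+1 jN)).
  by have [ts tsP] := choice ex; exists ts.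
have pre1 : pre_halts coin A S om t0 (ks 0).
  by have [t h] := ksP 0 (leq0n _); have [-> _] := halts_uniq pre0 h.
have x_le a : a \in shifted_input x -> a <= 2 * n ^ 2 by exact: (shifted_input_le x_range).
have := @ends_within_reduction (word_bits c n) (coin^~ om)
  (word_bits (jumbled_word A) s) (pre_prog A) (query_prog A) p B n (shifted_input x)
  [seq val a | a <- S] ks t0 ts (fun j => jumbled_occurs S (psi j)) B_gt1 P_gt B_least
  (size_shifted_input x) x_le (val_text_tuple p B_gt1 n y)
  word_ge word_gt.
rewrite size_map size_tuple => /(_ pre1 (fun j jN => (tsP j jN).1) (fun j jN => (tsP j jN).2)).
move=> /(ends_within_halts (erefl : pc (start n (shifted_input x)) = 0))[t [k [t_le h dk]]].
exists t, (goto k (csize (reduction p (pre_prog A) (query_prog A)))), t0, ts; split=> //.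
- move: dk; rewrite /decides /=.
  by have := conv3sum_occurs B_gt1 P_gt x_range; tauto.
- apply: running_time_uniq; first by exists (ks 0).
  by move=> t' [k' h']; have [] := halts_uniq h' pre1.
- move=> j jN; apply: running_time_uniq.
    by exists (ks j), (ks j.+1); split; [exact/ksP/ltnW|exact: (tsP j jN).1].
  move=> t' [k1 [k1' [h1 h1']]]; move: h1'.
  rewrite (session_uniq h1 (ksP j (ltnW jN))) => h1'.
  by have [] := halts_uniq h1' (tsP j jN).1.
Qed.

(** The almost sure bound of [ae_runs] is integrated term by term, and each expected time is bounded
    by the supremum to which it belongs. *)
Lemma expected_time_le :
  (\int[P]_om running_time R [set t | exists k, conv3sum_halts coin reduction_alg x om t k] <=
   ((overhead + N * (10 * p + 18))%:R)%:E + 2%:E * preprocessing_time P coin p.+3 A s +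
   ((2 * N)%:R)%:E * query_time P coin p.+3 A s)%E.
Proof.
have m_pre : measurable_fun setT pre_time by exact: (measurable_halts coinP).
have m_query j : measurable_fun setT (query_time_at j) by exact: (measurable_query_time coinP).
have pre_ge0 om : (0 <= pre_time om)%E by exact: running_time_ge0.
have query_ge0 j om : (0 <= query_time_at j om)%E by exact: running_time_ge0.
pose C : \bar R := ((overhead + N * (10 * p + 18))%:R)%:E.
have C0 : (0 <= C)%E by rewrite lee_fin.
pose F om : \bar R := (C + 2%:E * pre_time om + \sum_(j < N) 2%:E * query_time_at j om)%E.
have mF1 : measurable_fun setT (fun om => 2%:E * pre_time om)%E by exact: measurable_funeM.
have mF2 j : measurable_fun setT (fun om => 2%:E * query_time_at j om)%E by exact: measurable_funeM.
have mF3 : measurable_fun setT (fun om => \sum_(j < N) 2%:E * query_time_at j om)%E.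
  by apply: emeasurable_sum => j; exact: mF2.
have mF4 : measurable_fun setT (fun om => C + 2%:E * pre_time om)%E.
  by apply: emeasurable_funD => //; exact: measurable_cst.
have mF : measurable_fun setT F by exact: emeasurable_funD.
have ge1 om : (0 <= 2%:E * pre_time om)%E by exact: mule_ge0.
have ge2 j om : (0 <= 2%:E * query_time_at j om)%E by exact: mule_ge0.
have ge3 om : (0 <= \sum_(j < N) 2%:E * query_time_at j om)%E by exact: sume_ge0.
apply: (@le_trans _ _ (\int[P]_om F om)%E).
  apply: ae_ge0_le_integral => //.
  - by move=> om _; exact: running_time_ge0.
  - exact: (measurable_halts coinP).
  - by move=> om _; rewrite /F !adde_ge0.
  apply: filterS ae_runs => om [t [k [t0 [ts [h _ e0 es t_le]]]]] _.
  apply: (@le_trans _ _ (t%:R)%:E); first by apply: running_time_le; exists k.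
  rewrite /F e0 (eq_bigr (fun j : 'I_N => ((2 * ts j)%:R)%:E)); last first.
    by move=> j _; rewrite es // natrM EFinM.
  rewrite sumEFin -natr_sum /C -EFinM -!EFinD -natrM -!natrD lee_fin ler_nat.
  apply: leq_trans t_le _; rewrite big_split /= sum_nat_const card_ord.
  by apply: eq_leq; lia.
rewrite ge0_integralD //; last by move=> om _; rewrite adde_ge0.
rewrite ge0_integralD //.
have -> : (\int[P]__ C = C)%E.
  have -> := integral_cst P measurableT C.
  by rewrite [X in (_ * X)%E](_ : _ = 1%E) ?mule1 //; exact: probability_setT.
rewrite ge0_integralZl //.
rewrite ge0_integral_sum //.
apply: leeD; last first.
  apply: (@le_trans _ _ (\sum_(j < N) 2%:E * query_time P coin p.+3 A s)%E).
    apply: lee_sum => j _; rewrite ge0_integralZl // lee_pmul2l //.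
    apply: ereal_sup_ubound; exists S, (history j), (psi j); split=> //.
    by apply: word_queries_history.
  (* [query_time] may be infinite; the sum is turned into a product by induction, with
     distributivity over nonnegative factors. *)
  elim: (N) => [|m IH]; first by rewrite big_ord0 muln0 mul0e.
  rewrite big_ord_recr /= (_ : ((2 * m.+1)%:R)%:E = ((2 * m)%:R)%:E + 2%:E)%E; last first.
    by rewrite -EFinD -natrD mulnS addnC.
  by rewrite ge0_muleDl ?lee_fin // leeD.
apply: leeD => //; rewrite lee_pmul2l //.
by apply: ereal_sup_ubound; exists S.
Qed.

End Input.
End Expectation.

(** * Exponents and asymptotic bounds *)

Local Open Scope ring_scope.

(** [Omega] asks for a lower bound infinitely often, so its failure, already for the constant 1, is
    an upper bound for all large [s]. *)
Lemma not_Omega (R : realType) (f : nat -> \bar R) (g : nat -> R) : ~ Omega f g ->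
  exists N : nat, forall s, (N <= s)%N -> (f s < (g s)%:E)%E.
Proof.
move=> h; apply: contrapT => h'; apply: h; exists 1 => // N.
apply: contrapT => h2; apply: h'; exists N => s Ns.
rewrite ltNge; apply/negP => gf; apply: h2; exists s => //.
by rewrite mul1r.
Qed.

Lemma OmegaW (R : realType) (f : nat -> \bar R) (a e e' : R) : e <= e' ->
  Omega f (fun s => s%:R `^ (a - e)) -> Omega f (fun s => s%:R `^ (a - e')).
Proof.
(* [N.+1] ensures [s >= 1], where powers are monotone in the exponent. *)
move=> ee' [C C0 H]; exists C => // N; have [s Ns h] := H N.+1.
exists s; first exact: ltnW.
apply: le_trans h; rewrite lee_fin ler_pM2l // ler_powR //.
  by rewrite ler1n; apply: leq_ltn_trans Ns.
by rewrite lerD2l lerN2.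
Qed.

(** Take [m]-th roots and use that the root of [K >= 1] is at most [K]. This passes from integer
    powers to real exponents. *)
Lemma le_root_powR (R : realType) (m r K z n : nat) : (0 < m)%N -> (0 < K)%N ->
  (z ^ m <= K * n ^ r)%N -> z%:R <= K%:R * n%:R `^ (r%:R / m%:R) :> R.
Proof.
move=> m0 K0 h; have mR : m%:R != 0 :> R by rewrite pnatr_eq0 -lt0n.
have root (a : R) (i : nat) : 0 <= a -> a `^ (i%:R / m%:R) = (a ^+ i) `^ m%:R^-1.
  by move=> a0; rewrite powRrM powR_mulrn.
have -> : (z%:R : R) = (z%:R ^+ m) `^ m%:R^-1 by rewrite -root // divff // powRr1.
rewrite root //; apply: (@le_trans _ _ ((K%:R * n%:R ^+ r) `^ m%:R^-1)).
  apply: ge0_ler_powR; rewrite ?nnegrE ?invr_ge0 ?exprn_ge0 ?mulr_ge0 //.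
  by rewrite -!natrX -natrM ler_nat.
rewrite powRM ?exprn_ge0 // ler_wpM2r ?powR_ge0 // ler1_powR ?ler1n //.
by rewrite invf_le1 ?ltr0n // ler1n.
Qed.

(** All costs except those of the data structure are multiples of [n * B], and the first bound says,
    without roots, that [n * B] is of order [n ^ (r / (r - 2))]. *)
Lemma block_size_bounds p n B : (0 < n)%N -> (1 < B)%N ->
  (forall b, 1 < b < B -> b ^ p.+1 <= 2 * n ^ 2)%N ->
  let s := (n.-1 * block_size p B).+1 in
  [/\ ((n * B) ^ p.+1 <= (2 ^ p.+1 * 3) * n ^ p.+3)%N, (n <= s)%N,
      (s <= (3 * p + 4) * (n * B))%N &
      (p + 29 + B * (p + 6) + n * (9 * p + 22 + 5 * block_size p B) +
       n.-1 * 2 ^ p * (10 * p + 18) <=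
       (26 * p + 77 + 2 ^ p * (10 * p + 18)) * (n * B))%N].
Proof.
move=> n0 B1 least s; have LE : (block_size p B = (3 * p.+1 * B).+1)%N by [].
have B0 : (0 < B)%N by exact: ltnW.
have bsB : (block_size p B <= (3 * p + 4) * B)%N.
  by rewrite LE -addn1 (leq_trans (leq_add (leqnn _) B0)) //; apply: eq_leq; ring.
have nB : (n <= n * B)%N by rewrite leq_pmulr.
have BnB : (B <= n * B)%N by rewrite leq_pmull.
have nbs : (n * block_size p B <= (3 * p + 4) * (n * B))%N by rewrite mulnCA leq_mul2l bsB orbT.
have n_bs : (n.-1 * block_size p B + block_size p B = n * block_size p B)%N.
  by rewrite -mulSnr prednK.
split.
- rewrite expnMn; apply: (@leq_trans (n ^ p.+1 * (2 ^ p.+1 * (3 * n ^ 2)))%N).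
    rewrite leq_mul2l; apply/orP; right; apply: leq_trans (least_base_le B1 least) _.
    rewrite leq_mul2l; apply/orP; right.
    have : (0 < n ^ 2)%N by rewrite expn_gt0 n0.
    by lia.
  by rewrite -(addn2 p.+1) expnD; apply: eq_leq; ring.
- by rewrite /s; have : (n.-1 <= n.-1 * block_size p B)%N by [rewrite leq_pmulr]; lia.
- by rewrite /s; lia.
- have h1 : (n.-1 * 2 ^ p * (10 * p + 18) <= 2 ^ p * (10 * p + 18) * (n * B))%N.
    rewrite [(n.-1 * _)%N]mulnC mulnAC leq_mul2l; apply/orP; right.
    by apply: leq_trans nB; exact: leq_pred.
  have h2 : (B * (p + 6) <= (p + 6) * (n * B))%N by rewrite mulnC leq_mul2l BnB orbT.
  have h3 : (n * (9 * p + 22 + 5 * block_size p B) <= (9 * p + 22) * (n * B) + 5 * ((3 * p + 4) * (n * B)))%N.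
    rewrite mulnDr leq_add //; first by rewrite mulnC leq_mul2l nB orbT.
    by rewrite mulnCA leq_mul2l nbs orbT.
  have h4 : (p + 29 <= (p + 29) * (n * B))%N by rewrite leq_pmulr // muln_gt0 n0.
  have -> : ((26 * p + 77 + 2 ^ p * (10 * p + 18)) * (n * B) =
      (p + 29) * (n * B) + (p + 6) * (n * B) +
      ((9 * p + 22) * (n * B) + 5 * ((3 * p + 4) * (n * B))) +
      2 ^ p * (10 * p + 18) * (n * B))%N by ring.
  by rewrite !leq_add.
Qed.

Section Asymptotics.
Variables (R : realType) (p : nat) (eps : R).
Hypotheses (p_ge2 : (2 <= p)%N) (eps_gt0 : 0 < eps) (eps_le : eps <= 3^-1).
Let r : R := p.+3%:R.
Let m : R := p.+1%:R.

Let r_m : r = m + 2. Proof. by rewrite /r /m -natrD addn2. Qed.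
Let m_ge3 : 3 <= m. Proof. by rewrite /m ler_nat. Qed.
Let m_gt0 : 0 < m. Proof. exact: lt_le_trans m_ge3. Qed.
Let r_gt0 : 0 < r. Proof. by rewrite /r ltr0n. Qed.

(** Nonnegative exponents are needed to turn an upper bound on the text length into one on its
    power, in [powR_size_le]. *)
Lemma exponent_query_ge0 : 0 <= 1 - 2 / r - eps.
Proof.
have : 2 / r <= 2 / 5 by rewrite ler_pM2l // lef_pV2 ?posrE // r_m; have := m_ge3; lra.
move: eps_le; move: (2 / r) => a h1 h2; lra.
Qed.

Lemma exponent_pre_ge0 : 0 <= 2 - 4 / r - eps.
Proof.
have : 4 / r <= 4 / 5 by rewrite ler_pM2l // lef_pV2 ?posrE // r_m; have := m_ge3; lra.
move: eps_le; move: (4 / r) => a h1 h2; lra.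
Qed.

Lemma powR_size_le (K s n : nat) (a b : R) : (0 < n)%N -> 0 <= a -> r / m * a <= b ->
  s%:R <= K%:R * n%:R `^ (r / m) -> s%:R `^ a <= K%:R `^ a * n%:R `^ b.
Proof.
move=> n0 a0 ab h; apply: (@le_trans _ _ ((K%:R * n%:R `^ (r / m)) `^ a)).
  by apply: ge0_ler_powR; rewrite ?nnegrE ?mulr_ge0 ?powR_ge0.
rewrite powRM ?powR_ge0 // ler_wpM2l ?powR_ge0 // -powRrM.
by apply: ler_powR; rewrite ?ler1n.
Qed.

(** As [m = r - 2], the main part [r / m * (2 - 4 / r)] is exactly 2, and [eps] is only enlarged by
    the factor [r / m >= 1]. *)
Lemma exponent_pre : r / m * (2 - 4 / r - eps) <= 2 - eps.
Proof.
have -> : r / m * (2 - 4 / r - eps) = 2 - eps * (r / m).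
  have [r0 m0] : r != 0 /\ m != 0 by split; apply: lt0r_neq0.
  rewrite r_m in r0 *; move: m m0 r0 => m1 m0 r0.
  by field; rewrite m0 r0.
have : eps <= eps * (r / m).
  by rewrite ler_peMr ?(ltW eps_gt0) // ler_pdivlMr // mul1r r_m lerDl.
by move: (eps * (r / m)) => a; lra.
Qed.

Lemma exponent_query : r / m * (1 - 2 / r - eps) <= 1 - eps.
Proof.
have -> : r / m * (1 - 2 / r - eps) = 1 - eps * (r / m).
  have [r0 m0] : r != 0 /\ m != 0 by split; apply: lt0r_neq0.
  rewrite r_m in r0 *; move: m m0 r0 => m1 m0 r0.
  by field; rewrite m0 r0.
have : eps <= eps * (r / m).
  by rewrite ler_peMr ?(ltW eps_gt0) // ler_pdivlMr // mul1r r_m lerDl.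
by move: (eps * (r / m)) => a; lra.
Qed.

(** Here [r / m = 1 + 2 / m <= 5 / 3], with equality for [r = 5]; the bound 1/3 on [eps] is chosen
    for this. *)
Lemma exponent_text : r / m <= 2 - eps.
Proof.
rewrite r_m mulrDl divff ?lt0r_neq0 //.
have : 2 / m <= 2 / 3 by rewrite ler_pM2l // lef_pV2 ?posrE.
by move: eps_le; move: (2 / m) => a h1 h2; lra.
Qed.

Lemma total_time_le (n B s t : nat) (tp tq : \bar R) : (0 < n)%N ->
  ((n * B) ^ p.+1 <= (2 ^ p.+1 * 3) * n ^ p.+3)%N -> (s <= (3 * p + 4) * (n * B))%N ->
  (t <= (26 * p + 77 + 2 ^ p * (10 * p + 18)) * (n * B))%N ->
  (tp <= (s%:R `^ (2 - 4 / r - eps))%:E)%E -> (tq <= (s%:R `^ (1 - 2 / r - eps))%:E)%E ->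
  ((t%:R)%:E + 2%:E * tp + ((2 * (n.-1 * 2 ^ p))%:R)%:E * tq <=
   (((26 * p + 77 + 2 ^ p * (10 * p + 18)) * (2 ^ p.+1 * 3))%:R +
    2 * ((3 * p + 4) * (2 ^ p.+1 * 3))%:R `^ (2 - 4 / r - eps) +
    (2 * 2 ^ p)%:R * ((3 * p + 4) * (2 ^ p.+1 * 3))%:R `^ (1 - 2 / r - eps))%:E *
   (n%:R `^ (2 - eps))%:E)%E.
Proof.
move=> n0 hz hs ht hp hq.
set K0 := (2 ^ p.+1 * 3)%N in hz *; set K1 := (26 * p + _ + _)%N in ht *.
set e := (3 * p + 4)%N in hs *.
have K0_gt0 : (0 < K0)%N by rewrite muln_gt0 expn_gt0.
have z_le := le_root_powR R (ltn0Sn p) K0_gt0 hz; rewrite -/r -/m in z_le.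
have n1 : 1 <= n%:R :> R by rewrite ler1n.
have s_le : s%:R <= (e * K0)%:R * n%:R `^ (r / m) :> R.
  rewrite natrM -mulrA; apply: (@le_trans _ _ (e%:R * (n * B)%:R)); last by rewrite ler_wpM2l.
  by rewrite -natrM ler_nat.
have t_le : t%:R <= (K1 * K0)%:R * n%:R `^ (2 - eps) :> R.
  rewrite natrM -mulrA; apply: (@le_trans _ _ (K1%:R * (n * B)%:R)).
    by rewrite -natrM ler_nat.
  rewrite ler_wpM2l // (le_trans z_le) // ler_wpM2l //.
  by apply: ler_powR => //; exact: exponent_text.
have p_le := powR_size_le n0 exponent_pre_ge0 exponent_pre s_le.
have q_le := powR_size_le n0 exponent_query_ge0 exponent_query s_le.
rewrite -EFinM mulrDl (mulrDl _ _ (n%:R `^ _)) !EFinD; apply: leeD; first apply: leeD.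
- by rewrite lee_fin.
- apply: (le_trans (lee_wpmul2l _ hp)); first by rewrite lee_fin.
  by rewrite -EFinM lee_fin -mulrA ler_wpM2l.
- apply: (le_trans (lee_wpmul2l _ hq)); first by rewrite lee_fin.
  rewrite -EFinM lee_fin.
  have -> : n%:R `^ (2 - eps) = n%:R * n%:R `^ (1 - eps) :> R.
    have -> : 2 - eps = 1 + (1 - eps) by ring.
    by rewrite powRD ?powRr1 // pnatr_eq0 -lt0n n0 implybT.
  rewrite -mulrA [_ * (n%:R * _)]mulrCA [leRHS]mulrA ler_pM ?powR_ge0 //.
  by rewrite -natrM ler_nat -mulnA leq_mul2l mulnC leq_mul2l leq_pred !orbT.
Qed.

End Asymptotics.

Theorem theorem1 (R : realType) (d : measure_display) (Om : measurableType d)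
    (P : probability Om R) (coin : nat -> Om -> bool)
    (coinP : fair_coins P coin) (hard : conv3sum_hard P coin)
    (r : nat) (r_ge5 : (5 <= r)%N) (eps : R) (eps_gt0 : 0 < eps)
    (A : jumbled_alg) (A_solves : solves_jumbled P coin r A) :
  Omega (preprocessing_time P coin r A)
    (fun s : nat => (s%:R : R) `^ (2 - 4 / r%:R - eps)) \/
  Omega (query_time P coin r A)
    (fun s : nat => (s%:R : R) `^ (1 - 2 / r%:R - eps)).
Proof.
case: r r_ge5 A_solves => [|[|[|p]]] // r_ge5 A_solves.
have p_ge2 : (2 <= p)%N by [].
apply: contrapT => /not_orP[not_pre not_query].
(* A smaller [eps] makes both lower bounds stronger, so failure for [eps] implies failure for
   [e]. *)
pose e := Num.min eps 3^-1.
have e_gt0 : 0 < e by rewrite lt_min eps_gt0 invr_gt0 ltr0n.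
have e_eps : e <= eps by rewrite ge_min lexx.
have e_le : e <= 3^-1 by rewrite ge_min lexx orbT.
have {not_pre} /not_Omega[N1 pre_lt] : ~ Omega (preprocessing_time P coin p.+3 A)
    (fun s : nat => (s%:R : R) `^ (2 - 4 / p.+3%:R - e)).
  by apply: contra_not not_pre; exact: OmegaW.
have {not_query} /not_Omega[N2 query_lt] : ~ Omega (query_time P coin p.+3 A)
    (fun s : nat => (s%:R : R) `^ (1 - 2 / p.+3%:R - e)).
  by apply: contra_not not_query; exact: OmegaW.
have [c c_gt0 wordP] := word_size p A_solves.1.
pose A' := reduction_alg p A c.
have A'_solves : solves_conv3sum P coin A'.
  split=> // n x x_range; have [B [B1 PB least]] := least_base p n.
  have [w1 w2] := wordP n B B1 least.
  apply: filterS (ae_runs A_solves B1 PB least x_range w1 w2) => om.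
  by move=> [t [k [t0 [ts [h dk _ _ _]]]]]; exists t, k.
(* The constant is that of [total_time_le]; it depends on [p] and [e] only, so one [C] serves all
   [n]. *)
have [C time_le] : exists C : R, forall n, (0 < n)%N -> (N1 <= n)%N -> (N2 <= n)%N ->
    (conv3sum_time P coin A' n <= (C * n%:R `^ (2 - e))%:E)%E.
  eexists => n n0 N1n N2n; apply: ge_ereal_sup => _ [x x_range <-].
  have [B [B1 PB least]] := least_base p n; have [w1 w2] := wordP n B B1 least.
  have [hz ns hs ht] := block_size_bounds n0 B1 least.
  apply: le_trans (expected_time_le coinP A_solves B1 PB least x_range w1 w2) _.
  rewrite EFinM; apply: (total_time_le p_ge2 e_gt0 e_le n0 hz hs ht); apply: ltW.
    (* The text is at least as long as the input, so the thresholds carry over from [n] to [s]. *)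
    by apply: pre_lt; exact: leq_trans N1n ns.
  by apply: query_lt; exact: leq_trans N2n ns.
have [f f0 f_hard] := hard A' A'_solves.
have e2_gt0 : 0 < e / 2 by rewrite divr_gt0.
have [N3 _ f_lt] : \forall n \near \oo, f n < e / 2.
  have /cvgrPdist_lt/(_ _ e2_gt0) := f0; apply: filterS => n.
  by rewrite sub0r normrN; apply: le_lt_trans; exact: ler_norm.
(* From [N4] on, [C1 < n ^ (e / 2)], and from [N3] on, [2 - f n > 2 - e / 2]; together they
   contradict the upper bound [C * n ^ (2 - e)]. The maximum with 0 makes [C1] the [e / 2]-th power
   of its own [2 / e]-th power. *)
pose C1 := Num.max C 0.
pose N4 := (Num.trunc (C1 `^ (e / 2)^-1)).+1.
have [n] := f_hard (maxn (maxn N1 N2) (maxn N3 N4)).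
rewrite !geq_max => /andP[/andP[N1n N2n] /andP[N3n N4n]] hn.
have n0 : (0 < n)%N by exact: leq_ltn_trans N4n.
have n1 : 1 <= n%:R :> R by rewrite ler1n.
have := le_trans hn (time_le n n0 N1n N2n); rewrite lee_fin; apply/negP; rewrite -ltNge.
apply: (@lt_le_trans _ _ (n%:R `^ (e / 2 + (2 - e)))); last first.
  by apply: ler_powR => //; have := f_lt n N3n; lra.
rewrite [_ `^ (e / 2 + _)]powRD; last by rewrite (gt_eqF (lt_le_trans ltr01 n1)) implybT.
rewrite ltr_pM2r ?powR_gt0 ?(lt_le_trans ltr01 n1) //.
apply: (@le_lt_trans _ _ C1); first by rewrite le_max lexx.
have C1_ge0 : 0 <= C1 by rewrite le_max lexx orbT.
have -> : C1 = (C1 `^ (e / 2)^-1) `^ (e / 2).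
  by rewrite -powRrM mulVf ?powRr1 // gt_eqF.
apply: gt0_ltr_powR; rewrite ?nnegrE ?powR_ge0 //.
apply: (@lt_le_trans _ _ N4%:R); last by rewrite ler_nat.
by rewrite truncnS_gt.
Qed.
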